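(* Let $L/F$ be a finite extension of number fields, let $\widehat{L}$ be the normal closure of $L$ over $F$, let $G=\operatorname{Gal}(\widehat{L}/F)$, and suppose that $H=\operatorname{Gal}(\widehat{L}/L)$ is a non-normal maximal subgroup of $G$. Let $p$ be a prime, let $a=[F(\zeta_p):F]$, and suppose that $G$ does not have a cyclic quotient group of order $a$. Then for every elliptic curve $E/F$ we have $E(L)[p]=E(F)[p]$.
   Context: $\zeta_p$ denotes a primitive $p$-th root of unity. For a field $M\supseteq F$, $E(M)[p]$ denotes the group of points of $E(M)$ killed by $p$. *)

(* Defs.v *)
From mathcomp Require Import all_boot all_order all_algebra.
From mathcomp Require Import all_fingroup all_solvable all_field.

Set Implicit Arguments.
Unset Strict Implicit.
Unset Printing Implicit Defensive.

Import GRing.Theory.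
Local Open Scope ring_scope.

(* y^2 + a1 x y + a3 y = x^3 + a2 x^2 + a4 x + a6 *)
Record weierstrass (K : Type) :=
  Weierstrass { wa1 : K; wa2 : K; wa3 : K; wa4 : K; wa6 : K }.

Definition map_weierstrass (K M : Type) (f : K -> M) (E : weierstrass K) :=
  Weierstrass (f (wa1 E)) (f (wa2 E)) (f (wa3 E)) (f (wa4 E)) (f (wa6 E)).

Definition discriminant (K : fieldType) (E : weierstrass K) : K :=
  let: Weierstrass a1 a2 a3 a4 a6 := E in
  let b2 := a1 ^+ 2 + 4 * a2 in
  let b4 := 2 * a4 + a1 * a3 in
  let b6 := a3 ^+ 2 + 4 * a6 in
  let b8 := a1 ^+ 2 * a6 + 4 * a2 * a6 - a1 * a3 * a4
            + a2 * a3 ^+ 2 - a4 ^+ 2 in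
  - (b2 ^+ 2 * b8) - 8 * b4 ^+ 3 - 27 * b6 ^+ 2 + 9 * b2 * b4 * b6.

Definition elliptic (K : fieldType) (E : weierstrass K) : bool :=
  discriminant E != 0.

(* [None] is the point at infinity, the neutral element of the group law. *)
Definition point (K : Type) : Type := option (K * K).

Definition on_curve (K : fieldType) (E : weierstrass K) (P : point K) : bool :=
  if P is Some (x, y) then
    y ^+ 2 + wa1 E * x * y + wa3 E * y
      == x ^+ 3 + wa2 E * x ^+ 2 + wa4 E * x + wa6 E
  else true.

(* The chord-tangent law, defined on all pairs but meaningful on points of the
   curve: [l] is the slope of the line through the two points (of the tangent
   line if they are equal), (x3, l * (x3 - x1) + y1) is its third intersection
   with the curve, and the sum is the negative of that point, where
   - (x, y) = (x, - y - a1 x - a3). *)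
Definition add_point (K : fieldType) (E : weierstrass K) (P Q : point K) :
    point K :=
  match P, Q with
  | None, _ => Q
  | _, None => P
  | Some (x1, y1), Some (x2, y2) =>
    if (x1 == x2) && (y1 + y2 + wa1 E * x2 + wa3 E == 0) then None
    else
      let l :=
        if x1 == x2 then
          (3 * x1 ^+ 2 + 2 * wa2 E * x1 + wa4 E - wa1 E * y1)
            / (2 * y1 + wa1 E * x1 + wa3 E)
        else (y2 - y1) / (x2 - x1) in
      let x3 := l ^+ 2 + wa1 E * l - wa2 E - x1 - x2 in
      Some (x3, - (l * (x3 - x1) + y1) - wa1 E * x3 - wa3 E)
  end.

Definition muln_point (K : fieldType) (E : weierstrass K) (n : nat)
    (P : point K) : point K :=
  iter n (add_point E P) None.

Section RationalPoints.
Variables (F : fieldType) (N : fieldExtType F) (E : weierstrass F).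

Let EN : weierstrass N := map_weierstrass (in_alg N) E.

(* E(M), as a set of N-points, for a field M between F and N. *)
Definition rational_points (M : {subfield N}) : pred (point N) :=
  [pred P | on_curve EN P &&
    (if P is Some (x, y) then (x \in M) && (y \in M) else true)].

(* E(M)[n] *)
Definition torsion_points (M : {subfield N}) (n : nat) : pred (point N) :=
  [pred P | (P \in rational_points M) && (muln_point EN n P == None)].

End RationalPoints.

(* N is generated over F by L as a normal extension: no proper subfield of N
   containing L is normal over F. When N / F is itself normal this says that N
   is the normal closure of L over F. *)
Definition is_normal_closure (F : fieldType) (N : splittingFieldType F)
    (L : {subfield N}) : Prop :=
  forall K : {subfield N},
    (L <= K)%VS -> normalField 1%AS K -> (K : {vspace N}) = {:N}%VS.

Definition has_cyclic_quotient (gT : finGroupType) (G : {group gT}) (n : nat) :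
    Prop :=
  exists K : {group gT},
    [/\ (K <| G)%g, cyclic (G / K)%g & #|(G / K)%g| = n].

(* Main.v *)
From Stdlib Require Import Classical_Prop.
From HB Require Import structures.
Require Import Defs.
From mathcomp Require Import all_boot all_order all_algebra.
From mathcomp Require Import all_fingroup all_solvable all_field.
From mathcomp Require Import ring zify.

(* Suppose [P] is a [p]-torsion point over [L], not defined over [F]. By
   maximality its stabilizer in [G] is [H]; as [H] is not normal, some conjugate
   [Q] of [P] is not a multiple of [P], since otherwise all conjugates of [P]
   would have the same stabilizer. Two such independent [p]-torsion points over
   [Lhat] force a primitive [p]-th root of unity into [Lhat], so that
   [Gal(F(zeta) / F)], which is cyclic of order [a], is a quotient of [G].

   The root of unity is a value of the Weil pairing. Points are handled through
   the coordinate ring [K[x, y]] of the curve [y ^ 2 = q(x)]: a list of points is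
   the zero divisor of a function exactly when its sum is [0], which also yields
   the associativity of the chord-tangent law. For [p] odd there is therefore a
   function [g] with zeros [P + jQ] ([j < p]) and a pole of order [p] at infinity,
   and a function [k] with a zero of order [p] at [- Q]; comparing zeros,
   [g(Z + Q) k(Z) = c g(Z)] for a constant [c]. The pairing is the ratio of the
   constants [c] obtained for [P] and for [- P]. *)

Set Implicit Arguments.
Unset Strict Implicit.
Unset Printing Implicit Defensive.

Import GRing.Theory.
Local Open Scope ring_scope.

(** * Coordinate rings *)

(* [lia] takes convertible but syntactically distinct sizes for different
   atoms. *)
Ltac size_lia := repeat match goal with
  | H : is_true _ |- _ => revert H | H : @eq nat _ _ |- _ => revert H
  | H : ~ (@eq nat _ _) |- _ => revert H end;
  repeat match goal with |- context [@size ?T ?x] =>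
    let m := fresh in set m := (size x); clearbody m end;
  intros; lia.

(* (a, b) stands for a(x) + b(x) y, with y ^ 2 = q(x). *)
Definition crd (K : fieldType) (q : {poly K}) : Type := ({poly K} * {poly K})%type.

HB.instance Definition _ (K : fieldType) (q : {poly K}) :=
  GRing.Zmodule.copy (crd q) ({poly K} * {poly K})%type.

Section CoordinateRing.
Variables (K : fieldType) (q : {poly K}).
Implicit Types (f g h : crd q) (s t : seq (K * K)) (R S T : K * K).

Definition crd_one : crd q := (1, 0).
Definition crd_mul f g : crd q :=
  (f.1 * g.1 + f.2 * g.2 * q, f.1 * g.2 + f.2 * g.1).

Lemma crd_eqP f g : f.1 = g.1 -> f.2 = g.2 -> f = g.
Proof. by case: f g => [a b] [c d] /= -> ->. Qed.
Lemma crd_fstD f g : (f + g).1 = f.1 + g.1. Proof. by []. Qed.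
Lemma crd_sndD f g : (f + g).2 = f.2 + g.2. Proof. by []. Qed.
Lemma crd_fstN f : (- f).1 = - f.1. Proof. by []. Qed.
Lemma crd_sndN f : (- f).2 = - f.2. Proof. by []. Qed.

Fact crd_mulA : associative crd_mul.
Proof. by move=> f g h; rewrite /crd_mul /=; congr pair; ring. Qed.
Fact crd_mulC : commutative crd_mul.
Proof. by move=> f g; rewrite /crd_mul /=; congr pair; ring. Qed.
Fact crd_mul1 : left_id crd_one crd_mul.
Proof. by case=> a b; rewrite /crd_mul /= !mul1r !mul0r !addr0. Qed.
Fact crd_mulDl : left_distributive crd_mul +%R.
Proof.
move=> f g h; apply: crd_eqP;
  by rewrite ?(crd_fstD, crd_sndD) /= ?(crd_fstD, crd_sndD); ring.
Qed.
Fact crd_one_neq0 : crd_one != 0.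
Proof. by apply/eqP=> -[/eqP]; rewrite oner_eq0. Qed.

HB.instance Definition _ := GRing.Zmodule_isComNzRing.Build (crd q)
  crd_mulA crd_mulC crd_mul1 crd_mulDl crd_one_neq0.

Lemma crd_fstM f g : (f * g).1 = f.1 * g.1 + f.2 * g.2 * q. Proof. by []. Qed.
Lemma crd_sndM f g : (f * g).2 = f.1 * g.2 + f.2 * g.1. Proof. by []. Qed.
Lemma crd_fst1 : (1 : crd q).1 = 1. Proof. by []. Qed.
Lemma crd_snd1 : (1 : crd q).2 = 0. Proof. by []. Qed.
Definition crd_coord := (crd_fstD, crd_sndD, crd_fstN, crd_sndN, crd_fstM, crd_sndM,
  crd_fst1, crd_snd1).


Definition crdp (a : {poly K}) : crd q := (a, 0).
Definition crdy : crd q := (0, 1).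

Lemma crdpD a b : crdp (a + b) = crdp a + crdp b.
Proof. by apply: crd_eqP; rewrite !crd_coord /= ?addr0. Qed.
Lemma crdpN a : crdp (- a) = - crdp a.
Proof. by apply: crd_eqP; rewrite !crd_coord /= ?oppr0. Qed.
Lemma crdpM a b : crdp (a * b) = crdp a * crdp b.
Proof. by apply: crd_eqP; rewrite !crd_coord /=; ring. Qed.
Lemma crdE f : f = crdp f.1 + crdp f.2 * crdy.
Proof. by apply: crd_eqP; rewrite !crd_coord /=; ring. Qed.
Lemma crdyy : crdy * crdy = crdp q.
Proof. by apply: crd_eqP; rewrite !crd_coord /=; ring. Qed.

Fact crdp_zmod : zmod_morphism crdp.
Proof. by move=> a b; rewrite crdpD crdpN. Qed.
Fact crdp_monoid : monoid_morphism crdp.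
Proof. by split; [ | exact: crdpM]. Qed.
HB.instance Definition _ := GRing.isZmodMorphism.Build _ _ crdp crdp_zmod.
HB.instance Definition _ := GRing.isMonoidMorphism.Build _ _ crdp crdp_monoid.

Definition conjc f : crd q := (f.1, - f.2).
Fact conjc_zmod : zmod_morphism conjc.
Proof. by move=> f g; apply: crd_eqP; rewrite !crd_coord /= ?crd_coord; ring. Qed.
Fact conjc_monoid : monoid_morphism conjc.
Proof.
split=> [|f g]; apply: crd_eqP; rewrite ?crd_coord /= ?crd_coord ?oppr0 //; ring.
Qed.
HB.instance Definition _ := GRing.isZmodMorphism.Build _ _ conjc conjc_zmod.
HB.instance Definition _ := GRing.isMonoidMorphism.Build _ _ conjc conjc_monoid.

Definition nrm f : {poly K} := f.1 ^+ 2 - f.2 ^+ 2 * q.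

Lemma nrmM f g : nrm (f * g) = nrm f * nrm g.
Proof. by rewrite /nrm !crd_coord; ring. Qed.
Lemma nrm_conjc f : nrm (conjc f) = nrm f.
Proof. by rewrite /nrm /=; ring. Qed.

(* [sz f] is one more than the order of the pole of f at infinity. *)
Definition sz f := size (nrm f).

Lemma sz1 : sz 1 = 1%N.
Proof. by rewrite /sz /nrm !crd_coord expr1n expr0n mul0r subr0 size_poly1. Qed.

Lemma sz_scale (c : K) f : (sz (crdp c%:P * f)%R <= sz f)%N.
Proof.
rewrite /sz; have -> : nrm (crdp c%:P * f) = (c ^+ 2) *: nrm f.
  by rewrite /nrm !crd_coord /= -mul_polyC rmorphXn /=; ring.
exact: size_scale_leq.
Qed.

Lemma szN f : sz (- f) = sz f.
Proof. by rewrite /sz /nrm !crd_coord !sqrrN. Qed.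

Hypothesis size_q : size q = 4%N.

(** As [q] is cubic, the two terms of the norm have degrees of opposite parity, so their leading
    terms cannot cancel: [x] has a pole of order 2 and [y] one of order 3. *)
Lemma szE f : sz f = maxn (2 * size f.1 - 1) (if f.2 == 0 then 0 else 2 * size f.2 + 2).
Proof.
have q0 : q != 0 by rewrite -size_poly_gt0 size_q.
have sB : size (f.2 ^+ 2 * q) = if f.2 == 0 then 0%N else (2 * size f.2 + 2)%N.
  case: eqP => [->|/eqP b0]; first by rewrite expr0n mul0r size_poly0.
  rewrite size_mul ?expf_neq0 // size_q expr2 size_mul //.
  by move: b0; rewrite -size_poly_gt0; size_lia.
have sA : size (f.1 ^+ 2) = (2 * size f.1 - 1)%N.
  have [->|a0] := eqVneq f.1 0; first by rewrite expr0n size_poly0.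
  by rewrite expr2 size_mul //; size_lia.
rewrite -sB -sA /sz /nrm.
have [e|ne] := eqVneq (f.1) 0.
  by rewrite e expr0n /= sub0r size_polyN size_poly0 max0n.
have [e|ne2] := eqVneq (f.2) 0.
  by rewrite e expr0n /= mul0r subr0 size_poly0 maxn0.
move: ne; rewrite -size_poly_gt0 => ne.
have : size (f.1 ^+ 2) <> size (f.2 ^+ 2 * q).
  by rewrite sA sB (negPf ne2); lia.
move=> hne; case: (ltngtP (size (f.1 ^+ 2)) (size (f.2 ^+ 2 * q))) => // lt.
  by rewrite addrC size_polyDl ?size_polyN // maxnC /maxn lt.
by rewrite size_polyDl ?size_polyN // /maxn ltnNge ltnW.
Qed.

Lemma sz_eq0 f : (sz f == 0%N) = (f == 0).
Proof.
case: f => a b; rewrite szE /= xpair_eqE -(size_poly_eq0 a).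
by case: (b == 0); rewrite ?andbT ?andbF; size_lia.
Qed.

Lemma sz0 : sz 0 = 0%N.
Proof. by apply/eqP; rewrite sz_eq0. Qed.

(** Pole orders at infinity are sums of 2s and 3s, hence never 1; this later shows that a single
    affine point is not principal. *)
Lemma sz_neq2 f : sz f != 2%N.
Proof.
by rewrite szE; case: (eqVneq f.2) => [_|]; rewrite -?size_poly_gt0; size_lia.
Qed.

Lemma szD f g n : (sz f <= n)%N -> (sz g <= n)%N -> (sz (f + g)%R <= n)%N.
Proof.
have leD (a b : {poly K}) : (size (a + b)%R <= maxn (size a) (size b))%N.
  exact: size_polyD.
rewrite !szE !crd_coord; have := leD f.1 g.1; have := leD f.2 g.2.
case: (eqVneq f.2) => [->|]; case: (eqVneq g.2) => [->|];
  rewrite ?addr0 ?add0r ?eqxx ?size_poly0;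
  do ?[by move=> /negPf-> ; size_lia | size_lia].
by rewrite -?size_poly_gt0; case: eqP => _; size_lia.
Qed.

Lemma szM f g : sz (f * g) = if (f == 0) || (g == 0) then 0%N else (sz f + sz g).-1.
Proof.
rewrite -!sz_eq0 /sz nrmM !size_poly_eq0.
have [->|f0] := eqVneq; first by rewrite mul0r size_poly0.
have [->|g0] := eqVneq; first by rewrite mulr0 size_poly0.
by rewrite size_mul.
Qed.

Lemma crd_mul_eq0 f g : (f * g == 0) = (f == 0) || (g == 0).
Proof.
rewrite -(sz_eq0 (f * g)) szM; case: ifP => // /negbT.
by rewrite negb_or -!sz_eq0; case: (sz f) (sz_neq2 f) (sz g) => [|[|n]] // _ [|[|m]] //; lia.
Qed.

Lemma sz_conjc f : sz (conjc f) = sz f.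
Proof. by rewrite /sz nrm_conjc. Qed.

Definition crdX R : crd q := crdp ('X - R.1%:P).
Definition crdY R : crd q := crdy - crdp R.2%:P.

Lemma sz_crdp a : sz (crdp a) = (2 * size a - 1)%N.
Proof. by rewrite szE /= eqxx maxn0. Qed.
Lemma sz_crdX R : sz (crdX R) = 3%N.
Proof. by rewrite sz_crdp size_XsubC. Qed.
Lemma crdX_neq0 R : crdX R != 0.
Proof. by rewrite -sz_eq0 sz_crdX. Qed.

Lemma sz_crdY R : sz (crdY R) = 4%N.
Proof.
rewrite szE !crd_coord /= oppr0 addr0 add0r size_polyN oner_eq0 size_poly1.
by have := size_polyC_leq1 R.2; size_lia.
Qed.

Lemma sz_crdXn R n : sz (crdX R ^+ n) = (2 * n).+1.
Proof.
elim: n => [|n ih]; first by rewrite expr0 sz1.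
by rewrite exprS szM sz_crdX ih (negPf (crdX_neq0 R)) -sz_eq0 ih /=; lia.
Qed.

(* Membership in the product of the maximal ideals of the points of s. *)
Fixpoint van s f : Prop :=
  if s is R :: s' then
    exists f1 f2, [/\ van s' f1, van s' f2 & f = crdX R * f1 + crdY R * f2]
  else True.

Lemma vanD s f g : van s f -> van s g -> van s (f + g).
Proof.
elim: s f g => //= R s ih f g [f1 [f2 [h1 h2 ->]]] [g1 [g2 [k1 k2 ->]]].
by exists (f1 + g1), (f2 + g2); split; [exact: ih | exact: ih | ring].
Qed.

Lemma vanMl s f g : van s g -> van s (f * g).
Proof.
elim: s f g => //= R s ih f g [g1 [g2 [k1 k2 ->]]].
by exists (f * g1), (f * g2); split; [exact: ih | exact: ih | ring].
Qed.

Lemma vanN s f : van s f -> van s (- f).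
Proof. by rewrite -mulN1r; exact: vanMl. Qed.

Lemma vanB s f g : van s f -> van s g -> van s (f - g).
Proof. by move=> hf hg; apply: vanD => //; apply: vanN. Qed.

Lemma van0 s : van s 0.
Proof. by elim: s => //= R s ih; exists 0, 0; split=> //; ring. Qed.

Lemma vanX R s f : van s f -> van (R :: s) (crdX R * f).
Proof. by move=> h; exists f, 0; split=> //; [exact: van0 | ring]. Qed.

Lemma vanY R s f : van s f -> van (R :: s) (crdY R * f).
Proof. by move=> h; exists 0, f; split=> //; [exact: van0 | ring]. Qed.

Lemma van_catM s t f g : van s f -> van t g -> van (s ++ t) (f * g).
Proof.
elim: s f => [f _|R s ih f [f1 [f2 [h1 h2 ->]]]] hg; first exact: vanMl.
by exists (f1 * g), (f2 * g); split; [exact: ih | exact: ih | ring].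
Qed.

Lemma van_swap R S s f : van [:: R, S & s] f -> van [:: S, R & s] f.
Proof.
case=> f1 [f2 [[g1 [g2 [? ? ->]]] [h1 [h2 [? ? ->]]] ->]].
exists (crdX R * g1 + crdY R * h1), (crdX R * g2 + crdY R * h2).
by split; [apply: vanD; [exact: vanX | exact: vanY] |
           apply: vanD; [exact: vanX | exact: vanY] | ring].
Qed.

Lemma van_rot s1 R s f : van (s1 ++ R :: s) f <-> van (R :: s1 ++ s) f.
Proof.
elim: s1 f => //= S s1 ih f; split.
  move=> [f1 [f2 [/ih h1 /ih h2 ->]]]; apply: van_swap.
  by exists f1, f2.
by move=> /van_swap[f1 [f2 [h1 h2 ->]]]; exists f1, f2; split=> //; apply/ih.
Qed.

Lemma van_perm s t f : perm_eq s t -> van s f -> van t f.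
Proof.
elim: s t f => [|R s ih] t f.
  by rewrite perm_sym => /perm_nilP ->.
move=> pst; have Rt : R \in t by rewrite -(perm_mem pst) mem_head.
case/splitPr: Rt pst => t1 t2 pst [f1 [f2 [h1 h2 ->]]].
apply/van_rot; exists f1, f2.
have pst' : perm_eq s (t1 ++ t2).
  by move: pst; rewrite perm_sym perm_catC /= perm_cons perm_catC perm_sym.
by split=> //; exact: ih.
Qed.

Definition oppc R : K * K := (R.1, - R.2).

Lemma conjc_crdp a : conjc (crdp a) = crdp a.
Proof. by rewrite /conjc /= oppr0. Qed.
Lemma conjc_crdX R : conjc (crdX R) = crdX R.
Proof. exact: conjc_crdp. Qed.
Lemma conjc_crdY R : conjc (crdY R) = - crdY (oppc R).
Proof.
rewrite /crdY rmorphB /= conjc_crdp polyCN crdpN.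
have -> : conjc crdy = - crdy by apply: crd_eqP; rewrite !crd_coord //= oppr0.
by ring.
Qed.

Lemma van_conjc s f : van s f -> van (map oppc s) (conjc f).
Proof.
elim: s f => //= R s ih f [f1 [f2 [/ih h1 /ih h2 ->]]].
exists (conjc f1), (- conjc f2); split=> //; first exact: vanN.
rewrite rmorphD !rmorphM /= conjc_crdX conjc_crdY.
by have -> : crdX (oppc R) = crdX R by []; ring.
Qed.

Definition onc R := R.2 ^+ 2 == q.[R.1].

Lemma onc_factor R : onc R ->
  exists u, q - (R.2 ^+ 2)%:P = ('X - R.1%:P) * u.
Proof.
move=> /eqP ->; have /factor_theorem[u ->] : root (q - (q.[R.1])%:P) R.1.
  by rewrite /root !hornerE subrr.
by exists u; rewrite mulrC.
Qed.

Lemma crdY_opp R u : q - (R.2 ^+ 2)%:P = ('X - R.1%:P) * u ->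
  crdY R * crdY (oppc R) = crdX R * crdp u.
Proof.
move=> hu; rewrite /crdX -crdpM -hu crdpD -crdyy /crdY.
by rewrite !(crdpN, polyCN, rmorphXn) /=; ring.
Qed.

(** The product of the two ideals is generated by [(x - x_R) ^ 2], [(x - x_R)(y + y_R)],
    [(x - x_R)(y - y_R)] and [y ^ 2 - y_R ^ 2]; the last is also a multiple of [x - x_R], since
    [x_R] is a root of [q - y_R ^ 2]. *)
Lemma van_cancel R s f : onc R -> van [:: R, oppc R & s] f ->
  exists2 f', van s f' & f = crdX R * f'.
Proof.
move=> /onc_factor[u hu] [f1 [f2 [[g1 [g2 [? ? ->]]] [h1 [h2 [? ? ->]]] ->]]].
exists (crdX R * g1 + crdY (oppc R) * g2 + crdY R * h1 + crdp u * h2).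
  by do ![apply: vanD]; apply: vanMl.
have e : crdX (oppc R) = crdX R by [].
rewrite e; have := crdY_opp hu; move: (crdY R) (crdY (oppc R)) (crdX R) => y y' x E.
transitivity (x * x * g1 + x * y' * g2 + x * y * h1 + (y * y') * h2); first ring.
by rewrite E; ring.
Qed.

(** Each point contributes a factor [x - x_R], as in [van_cancel]. Two functions are carried because
    the induction meets mixed products. *)
Lemma van_norm s f g : all onc s -> van s f -> van s g ->
  exists h, f * conjc g = (\prod_(R <- s) crdX R) * h.
Proof.
elim: s f g => [|R s ih] f g /=; first by exists (f * conjc g); rewrite big_nil mul1r.
case/andP=> oR os [f1 [f2 [h1 h2 ->]]] [g1 [g2 [k1 k2 ->]]].
have [u hu] := onc_factor oR.
have [a ha] := ih _ _ os h1 k1; have [b hb] := ih _ _ os h1 k2.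
have [c hc] := ih _ _ os h2 k1; have [d hd] := ih _ _ os h2 k2.
rewrite big_cons.
exists (crdX R * a - crdY (oppc R) * b + crdY R * c - crdp u * d).
rewrite rmorphD !rmorphM /= conjc_crdX conjc_crdY.
have := crdY_opp hu; move: (crdY R) (crdY (oppc R)) (crdX R) => y y' x E.
move: (\prod_(i <- s) crdX i) (crdp u) ha hb hc hd E => Q v ha hb hc hd E.
transitivity (x * x * (f1 * conjc g1) - x * y' * (f1 * conjc g2)
  + x * y * (f2 * conjc g1) - (y * y') * (f2 * conjc g2)); first ring.
by rewrite E ha hb hc hd; ring.
Qed.

Lemma sz_prod_crdX s : sz (\prod_(R <- s) crdX R) = (2 * size s).+1.
Proof.
elim: s => [|R s ih]; first by rewrite big_nil sz1.
rewrite big_cons szM sz_crdX ih (negPf (crdX_neq0 R)) -sz_eq0 ih /=; lia.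
Qed.

(** A function has no more zeros than the order of its pole: by [van_norm] the product of the
    [x - x_R] divides [f * conjc f], and sizes are compared. *)
Lemma van_sz s f : all onc s -> van s f -> f != 0 -> (size s < sz f)%N.
Proof.
move=> os hf f0; have [h e] := van_norm os hf hf.
have := congr1 sz e; rewrite !szM sz_prod_crdX -!sz_eq0 sz_prod_crdX sz_conjc.
have : sz h != 0%N.
  apply/negP; rewrite sz_eq0 => /eqP h0; move/eqP: e; rewrite h0 mulr0.
  by rewrite crd_mul_eq0 -!sz_eq0 sz_conjc orbb sz_eq0 (negPf f0).
rewrite -sz_eq0 in f0; move=> h0; rewrite (negPf f0) (negPf h0) /=; lia.
Qed.

(** * Evaluation at points and simple zeros *)

Definition ev R f : K := f.1.[R.1] + f.2.[R.1] * R.2.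

Let hE := (hornerD, hornerN, hornerM, hornerC, hornerX).

Lemma evD R f g : ev R (f + g) = ev R f + ev R g.
Proof. by rewrite /ev !crd_coord !hE; ring. Qed.
Lemma evN R f : ev R (- f) = - ev R f.
Proof. by rewrite /ev !crd_coord !hE; ring. Qed.
Lemma evB R f g : ev R (f - g) = ev R f - ev R g.
Proof. by rewrite evD evN. Qed.
Lemma evM R f g : onc R -> ev R (f * g) = ev R f * ev R g.
Proof. by rewrite /ev !crd_coord !hE => /eqP <-; ring. Qed.
Lemma ev1 R : ev R 1 = 1.
Proof. by rewrite /ev !crd_coord !hE; ring. Qed.
Lemma ev_crdp R a : ev R (crdp a) = a.[R.1].
Proof. by rewrite /ev /= !hE; ring. Qed.
Lemma ev_crdX R S : ev R (crdX S) = R.1 - S.1.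
Proof. by rewrite ev_crdp !hE. Qed.
Lemma ev_crdY R S : ev R (crdY S) = R.2 - S.2.
Proof. by rewrite evB ev_crdp /ev !hE; ring. Qed.

Lemma van_ev s f R : onc R -> R \in s -> van s f -> ev R f = 0.
Proof.
move=> oR /splitPr[s1 s2] /van_rot[f1 [f2 [_ _ ->]]].
by rewrite evD !evM // ev_crdX ev_crdY !subrr !mul0r addr0.
Qed.

Lemma van1 R f : ev R f = 0 -> van [:: R] f.
Proof.
(* Modulo [y - R.2], [f] is the polynomial [f.1 + f.2 * R.2] in [x], which vanishes at [R.1]. *)
move=> h; have /factor_theorem[u hu] : root (f.1 + f.2 * R.2%:P) R.1.
  by rewrite /root !hE -[X in X == _]/(ev R f) h.
exists (crdp u), (crdp f.2); split=> //.
rewrite [LHS]crdE -[f.1](addrK (f.2 * R.2%:P)) hu /crdX /crdY !(crdpD, crdpN, crdpM).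
by ring.
Qed.

(** Each point [S] of [s] differs from [R] in some coordinate, so a scalar multiple of [x - x_S] or
    [y - y_S] takes the value 1 at [R]; these factors are multiplied. *)
Lemma van_unit s R : onc R -> R \notin s -> exists2 u, van s u & ev R u = 1.
Proof.
move=> oR; elim: s => [|S s ih]; first by exists 1; rewrite ?ev1.
rewrite in_cons negb_or => /andP[ne /ih[u hu e]].
have [e1|n1] := eqVneq R.1 S.1.
  have n2 : R.2 - S.2 != 0.
    rewrite subr_eq0; apply: contraNneq ne => e2.
    by rewrite [R]surjective_pairing e1 e2 -surjective_pairing.
  exists (crdY S * (crdp (R.2 - S.2)^-1%:P * u)).
    by apply: vanY; exact: vanMl.
  by rewrite !evM // ev_crdY ev_crdp hornerC e mulr1 divff.
rewrite -subr_eq0 in n1.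
exists (crdX S * (crdp (R.1 - S.1)^-1%:P * u)).
  by apply: vanX; exact: vanMl.
by rewrite !evM // ev_crdX ev_crdp hornerC e mulr1 divff.
Qed.

(** A Chinese remainder argument: with [u] in the ideal of [s] and [1 - u] in that of [R], both
    [f * u] and [(1 - u) * f] lie in the product. *)
Lemma van_add s f R : onc R -> R \notin s -> van s f -> ev R f = 0 -> van (R :: s) f.
Proof.
move=> oR nR hf e; have [u hu e1] := van_unit oR nR.
have -> : f = f * u + (1 - u) * f by ring.
apply: vanD; first exact: (@van_catM [:: R] s _ _ (van1 e) hu).
apply: (@van_catM [:: R]) => //; apply: van1.
by rewrite evB ev1 e1 subrr.
Qed.

Lemma van_uniq s t f : all onc s -> uniq s -> (forall R, R \in s -> R \notin t) ->
  (forall R, R \in s -> ev R f = 0) -> van t f -> van (s ++ t) f.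
Proof.
elim: s => //= R s ih /andP[oR os] /andP[nR us] dis e ht.
apply: van_add => //.
- by rewrite mem_cat negb_or nR dis ?mem_head.
- by apply: ih => // S hS; [apply: dis | apply: e]; rewrite in_cons hS orbT.
- by apply: e; rewrite mem_head.
Qed.

(* With a pole of odd order the leading coefficient is that of the y-part. *)
Lemma van_uniq_scal s f g : all onc s -> odd (size s) -> van s f -> van s g ->
  (sz f <= (size s).+1)%N -> (sz g <= (size s).+1)%N -> f != 0 ->
  exists c : K, g = crdp c%:P * f.
Proof.
move=> os odd_s hf hg sf sg f0.
have szf : sz f = (size s).+1 by have := van_sz os hf f0; lia.
set k := ((size s) %/ 2)%N.
have sk : size s = (2 * k + 1)%N.
  by rewrite /k {1}(divn_eq (size s) 2) modn2 odd_s mulnC.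
have nb : f.2 != 0.
  apply: contraPneq szf => f20; rewrite szE f20 eqxx; lia.
have sb : size f.2 = k.
  by move: szf; rewrite szE (negPf nb) => h; move: nb; rewrite -size_poly_gt0; lia.
have sgb : (size g.2 <= k)%N.
  by move: sg; rewrite szE; case: eqP => [->|_]; rewrite ?size_poly0; lia.
have k0 : (0 < k)%N by rewrite -sb size_poly_gt0.
(* This constant cancels the leading coefficient of the [y]-part of [g - c f]. The pole order of the
   difference drops below the number of zeros, so the difference is 0 by [van_sz]. *)
set c := g.2`_k.-1 / lead_coef f.2; exists c.
apply/eqP; rewrite -subr_eq0; apply: contraT => n0.
have := van_sz os (vanB hg (vanMl (crdp c%:P) hf)) n0.
suff : (sz (g - crdp c%:P * f)%R <= size s)%N by lia.
have le : (sz (g - crdp c%:P * f)%R <= (size s).+1)%N.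
  by apply: szD => //; rewrite szN; exact: leq_trans (sz_scale _ _) sf.
have e2 : (g - crdp c%:P * f).2 = g.2 - c *: f.2.
  by rewrite !crd_coord /= -mul_polyC; ring.
have lt2 : (size (g.2 - c *: f.2)%R < k)%N.
  rewrite -(prednK k0) ltnS; apply/leq_sizeP => j hj.
  rewrite coefB coefZ; case: (ltngtP j k.-1) => [|hj'|->]; first lia.
    by rewrite !nth_default ?mulr0 ?subr0 //; size_lia.
  by rewrite /c /lead_coef sb divfK ?subrr // -sb -/(lead_coef _) lead_coef_eq0.
move: le; rewrite !szE e2; case: eqP => _; lia.
Qed.

End CoordinateRing.

(** * The cubic and its lines *)

(** The condition on 2 allows the square to be completed, so that functions live in a ring [K[x, Y]]
    with [Y ^ 2] a cubic in [x]. *)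
Record smooth_curve (K : fieldType) := SmoothCurve {
  wei :> weierstrass K;
  two_neq0 : (2 : K) != 0;
  wei_elliptic : elliptic wei }.

Section Cubic.
Variables (K : fieldType) (E : weierstrass K).

Definition h1 : K := wa1 E / 2.
Definition h3 : K := wa3 E / 2.

(* Completing the square, [Y = y + (a1 x + a3) / 2] satisfies [Y ^ 2 = cubic]. *)
Definition sqc (P : K * K) : K * K := (P.1, P.2 + h1 * P.1 + h3).

Definition cubic : {poly K} :=
  'X^3 + (wa2 E + h1 ^+ 2)%:P * 'X^2 + (wa4 E + 2 * h1 * h3)%:P * 'X
  + (wa6 E + h3 ^+ 2)%:P.

(** [T] is the sum of [R] and [S]: the line [Y = m X + c] meets the cubic at [R], [S] and the
    negative of [T]. The last clause excludes the doubling of a point with [Y = 0], whose tangent is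
    vertical. *)
Definition collinear (m c : K) (R S T : K * K) :=
  [/\ cubic = ('X - R.1%:P) * ('X - S.1%:P) * ('X - T.1%:P) + (m%:P * 'X + c%:P) ^+ 2,
      R.2 = m * R.1 + c, S.2 = m * S.1 + c, T.2 = - (m * T.1 + c)
    & (R.1 != S.1) || (R.2 != 0)].

Lemma size_cubic : size cubic = 4%N.
Proof.
rewrite /cubic -!addrA size_polyDl ?size_polyXn //.
rewrite (leq_ltn_trans (size_polyD _ _)) // gtn_max mul_polyC.
rewrite (leq_ltn_trans (size_scale_leq _ _)) ?size_polyXn //=.
rewrite (leq_ltn_trans (size_polyD _ _)) // gtn_max mul_polyC.
rewrite (leq_ltn_trans (size_scale_leq _ _)) ?size_polyX //=.
by rewrite (leq_ltn_trans (size_polyC_leq1 _)).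
Qed.

Lemma horner_cubic r : cubic.[r] = r ^+ 3 + (wa2 E + h1 ^+ 2) * r ^+ 2
  + (wa4 E + 2 * h1 * h3) * r + (wa6 E + h3 ^+ 2).
Proof. by rewrite !(hornerD, hornerM, hornerC, hornerX, hornerXn). Qed.

Lemma deriv_cubic r : cubic^`().[r] = 3 * r ^+ 2 + 2 * (wa2 E + h1 ^+ 2) * r
  + (wa4 E + 2 * h1 * h3).
Proof.
rewrite !(derivD, derivM, derivC, derivX, derivXn) /=.
by rewrite !(hornerD, hornerM, hornerC, hornerX, hornerXn, hornerMn) /=; ring.
Qed.

(** Comparison of the coefficients of [X ^ 2] in the factorization of the cubic minus the squared
    line. *)
Lemma collinear_sum_fst m c R S T : collinear m c R S T ->
  wa2 E + h1 ^+ 2 = m ^+ 2 - (R.1 + S.1 + T.1).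
Proof.
have coef2 (a b d : K) : ('X^3 + a%:P * 'X^2 + b%:P * 'X + d%:P)`_2 = a.
  by rewrite !coefE /= mulr0 mulr1 add0r !addr0.
case=> e _ _ _ _; rewrite -[LHS](coef2 _ (wa4 E + 2 * h1 * h3) (wa6 E + h3 ^+ 2)).
rewrite -/cubic -[RHS](coef2 _ (2 * m * c + R.1 * S.1 + S.1 * T.1 + T.1 * R.1)
  (c ^+ 2 - R.1 * S.1 * T.1)).
by rewrite e; set u := _ + _ ^+ 2; set v := _ + _%:P; have -> : u = v by rewrite /u /v; ring.
Qed.

Hypothesis two0 : (2 : K) != 0.

Lemma wa1E : wa1 E = 2 * h1. Proof. by rewrite /h1 mulrC divfK. Qed.
Lemma wa3E : wa3 E = 2 * h3. Proof. by rewrite /h3 mulrC divfK. Qed.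

Lemma on_curveE x y : on_curve E (Some (x, y)) = onc cubic (sqc (x, y)).
Proof.
rewrite /on_curve /onc horner_cubic /= wa1E wa3E -subr_eq0 -[RHS]subr_eq0.
by congr (_ == 0); ring.
Qed.

(** A common root of the cubic and its derivative determines [a4] and [a6] from the other data, and
    the discriminant then vanishes identically. *)
Lemma cubic_smooth r : elliptic E -> cubic.[r] = 0 -> cubic^`().[r] != 0.
Proof.
rewrite /elliptic horner_cubic deriv_cubic => ell e0; apply: contraNneq ell => e1.
have {}e1 : wa4 E = - (3 * r ^+ 2 + 2 * (wa2 E + h1 ^+ 2) * r) - 2 * h1 * h3.
  by apply/eqP; rewrite -subr_eq0 -e1; apply/eqP; ring.
have {}e0 : wa6 E = - (r ^+ 3 + (wa2 E + h1 ^+ 2) * r ^+ 2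
  + (wa4 E + 2 * h1 * h3) * r) - h3 ^+ 2.
  by apply/eqP; rewrite -subr_eq0 -e0; apply/eqP; ring.
have := wa1E; have := wa3E; move: e0 e1; move: h1 h3.
case: E => a1 a2 a3 a4 a6 /= b1 b3 -> -> -> ->.
by apply/eqP; rewrite /discriminant; ring.
Qed.

Lemma add_collinear x1 y1 x2 y2 :
  on_curve E (Some (x1, y1)) -> on_curve E (Some (x2, y2)) ->
  ~~ ((x1 == x2) && (y1 + y2 + wa1 E * x2 + wa3 E == 0)) ->
  exists m c T, add_point E (Some (x1, y1)) (Some (x2, y2)) = Some T /\
    collinear m c (sqc (x1, y1)) (sqc (x2, y2)) (sqc T).
Proof.
rewrite !on_curveE /onc /= => /eqP; rewrite horner_cubic => q1.
move=> /eqP; rewrite horner_cubic => q2 nopp.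
rewrite (negPf nopp).
set l := if x1 == x2 then _ else _.
set t := l ^+ 2 + _ - _ - _ - _.
(* Completing the square adds [h1 * x + h3] to the ordinate, hence [h1] to the slope. *)
set m := l + h1; set c := y1 + h1 * x1 + h3 - m * x1.
exists m, c, (t, - (l * (t - x1) + y1) - wa1 E * t - wa3 E); split=> //.
have At : wa2 E + h1 ^+ 2 = m ^+ 2 - (x1 + x2 + t) by rewrite /t /m wa1E; ring.
(* By the choice of [t], the cubic minus the product of linear factors and the squared line is the
   linear polynomial [be X + ga]. It vanishes at [x1]; vanishing also at [x2], or the tangent slope
   when [x1 = x2], gives [be = 0]. *)
set be := (wa4 E + 2 * h1 * h3) - (2 * m * c + x1 * x2 + x2 * t + t * x1).
set ga := (wa6 E + h3 ^+ 2) - (c ^+ 2 - x1 * x2 * t).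
have bg1 : be * x1 + ga = 0.
  transitivity (x1 ^+ 3 + (wa2 E + h1 ^+ 2) * x1 ^+ 2 + (wa4 E + 2 * h1 * h3) * x1
    + (wa6 E + h3 ^+ 2) - (y1 + h1 * x1 + h3) ^+ 2); last by rewrite q1 subrr.
  by rewrite At /be /ga /c; ring.
have [S2 be0 ne] : [/\ y2 + h1 * x2 + h3 = m * x2 + c, be = 0 &
    (x1 != x2) || (y1 + h1 * x1 + h3 != 0)].
  move: nopp; have [e|ne] := eqVneq x1 x2 => /= nopp.
    have y12 : y2 = y1.
      have : (y2 - y1) * (y1 + y2 + wa1 E * x2 + wa3 E) = 0.
        move: (q1); rewrite e -q2 wa1E wa3E => q3.
        transitivity ((y2 + h1 * x2 + h3) ^+ 2 - (y1 + h1 * x2 + h3) ^+ 2); first ring.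
        by rewrite q3 subrr.
      by move/eqP; rewrite mulf_eq0 (negPf nopp) orbF subr_eq0 => /eqP.
    have Y0 : y1 + h1 * x1 + h3 != 0.
      apply: contraNneq nopp => h; rewrite y12 -e wa1E wa3E.
      by rewrite -[X in _ == X](mulr0 2) -h; apply/eqP; ring.
    split=> //; first by rewrite y12 -e /c; ring.
    have hl : l * (2 * (y1 + h1 * x1 + h3)) = 3 * x1 ^+ 2 + 2 * wa2 E * x1 + wa4 E - wa1 E * y1.
      rewrite /l e eqxx -e wa1E wa3E.
      have -> : 2 * (y1 + h1 * x1 + h3) = 2 * y1 + 2 * h1 * x1 + 2 * h3 by ring.
      rewrite divfK //; apply: contraNneq nopp => h; rewrite y12 -e wa1E wa3E -h.
      by apply/eqP; ring.
    transitivity (l * (2 * (y1 + h1 * x1 + h3))  - (2 * l * (y1 + h1 * x1 + h3))); last ring.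
    by rewrite hl /be /c /t -e wa1E /m; ring.
  have hl : l * (x2 - x1) = y2 - y1.
    by rewrite /l (negPf ne) divfK // subr_eq0 eq_sym.
  have S2 : y2 + h1 * x2 + h3 = m * x2 + c.
    rewrite /c /m; transitivity ((y2 - y1) + y1 + h1 * x2 + h3); first ring.
    by rewrite -hl; ring.
  split=> //.
  have bg2 : be * x2 + ga = 0.
    transitivity (x2 ^+ 3 + (wa2 E + h1 ^+ 2) * x2 ^+ 2 + (wa4 E + 2 * h1 * h3) * x2
      + (wa6 E + h3 ^+ 2) - (y2 + h1 * x2 + h3) ^+ 2); last by rewrite q2 subrr.
    by rewrite At S2 /be /ga; ring.
  have /eqP : be * (x1 - x2) = 0.
    by transitivity (be * x1 + ga - (be * x2 + ga)); [ring | rewrite bg1 bg2 subrr].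
  by rewrite mulf_eq0 [x1 - x2 == 0]subr_eq0 (negPf ne) orbF => /eqP.
have ga0 : ga = 0 by move: bg1; rewrite be0 mul0r add0r.
split=> //=.
- have -> : cubic = ('X - x1%:P) * ('X - x2%:P) * ('X - t%:P) + (m%:P * 'X + c%:P) ^+ 2
     + be%:P * 'X + ga%:P by rewrite /cubic At /be /ga; ring.
  by rewrite be0 ga0 mul0r !addr0.
- by rewrite /c; ring.
- by rewrite wa1E wa3E /c /m; ring.
Qed.

End Cubic.

(** * Zeros of vertical and oblique lines *)

Section Lines.
Variables (K : fieldType) (q : {poly K}).
Hypothesis size_q : size q = 4%N.
Hypothesis two0 : (2 : K) != 0.
Hypothesis smooth : forall r, q.[r] = 0 -> q^`().[r] != 0.

Let kc (a : K) : crd q := crdp q a%:P.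
Let kcK (a : K) f : a != 0 -> f = kc a^-1 * (kc a * f).
Proof.
by move=> a0; rewrite mulrA -rmorphM -polyCM mulVf // !rmorph1 mul1r.
Qed.

Let crdXE (R : K * K) : crdX q R = crdp q 'X - kc R.1.
Proof. by rewrite /crdX rmorphB. Qed.
Let crdYE (R : K * K) : crdY q R = crdy q - kc R.2.
Proof. by []. Qed.

Lemma van_scal (a : K) s f : a != 0 -> van s (kc a * f) -> van s f.
Proof. by move=> a0 h; rewrite (kcK f a0); exact: vanMl. Qed.

(** If [R.2] is nonzero, [2 * R.2] times [x - x_R] is a combination of generators of the product. If
    [R.2 = 0], then [y ^ 2 = (x - x_R) u] with [u] nonzero at [x_R] by smoothness, and [x - x_R] is
    recovered from [y ^ 2] and [(x - x_R) ^ 2]. *)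
Lemma van_vertical (R : K * K) : onc q R -> van [:: R; oppc R] (crdX q R).
Proof.
move=> oR; have [u hu] := onc_factor oR; have hY := crdY_opp hu.
set s := [:: R; _].
have XX : van s (crdX q R * crdX q R).
  by rewrite -[X in _ * X]mulr1; do 2![apply: vanX].
have XY : van s (crdX q R * crdY q (oppc R)).
  by rewrite -[crdY q _]mulr1; apply: vanX; apply: vanY.
have YX : van s (crdY q R * crdX q R).
  by rewrite -[crdX q _]mulr1; apply: vanY; apply: (@vanX _ _ (oppc R)).
have YY : van s (crdY q R * crdY q (oppc R)).
  by rewrite -[crdY q (oppc R)]mulr1; apply: vanY; apply: vanY.
have [R20|R20] := eqVneq R.2 0; last first.
  apply: (@van_scal (2 * R.2)); first by rewrite mulf_neq0.
  have -> : kc (2 * R.2) * crdX q R = crdX q R * crdY q (oppc R) - crdY q R * crdX q R.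
    by rewrite !crdYE /kc /= polyCN polyCM !rmorphM /= !rmorphN /=; ring.
  exact: vanB.
have du : q^`().[R.1] = u.[R.1].
  have -> : q = ('X - (R.1)%:P) * u + (R.2 ^+ 2)%:P by rewrite -hu subrK.
  rewrite !(derivD, derivM, derivC, derivX, derivN).
  by rewrite !(hornerD, hornerM, hornerN, hornerC, hornerX); ring.
have u0 : u.[R.1] != 0.
  by rewrite -du; apply: smooth; apply/eqP; rewrite -(eqP oR) R20 expr0n.
have /factor_theorem[v hv] : root (u - u.[R.1]%:P) R.1 by rewrite /root !hornerE subrr.
apply: (van_scal u0).
have -> : kc u.[R.1] * crdX q R
    = crdY q R * crdY q (oppc R) - crdp q v * (crdX q R * crdX q R).
  rewrite hY; have -> : crdp q u = crdp q v * crdX q R + kc u.[R.1].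
    by rewrite -rmorphM -hv rmorphB /= subrK.
  by ring.
by apply: vanB => //; apply: vanMl.
Qed.

(** The ideal of each of the three points is generated by the line [l] and the corresponding
    [x - x_i], and [l] times [y + m x + c] is the product of the three [x - x_i]. In each case a
    nonzero constant times [l] is expressed through products of generators. *)
Lemma van_line (m c : K) (R S T : K * K) :
  q = ('X - R.1%:P) * ('X - S.1%:P) * ('X - T.1%:P) + (m%:P * 'X + c%:P) ^+ 2 ->
  R.2 = m * R.1 + c -> S.2 = m * S.1 + c -> T.2 = - (m * T.1 + c) ->
  (R.1 != S.1) || (R.2 != 0) ->
  van [:: R; S; oppc T] (crdy q - crdp q (m%:P * 'X + c%:P)).
Proof.
move=> eq_q R2 S2 T2 dist.
have yy : crdy q * crdy q = crdX q R * crdX q S * crdX q T + crdp q (m%:P * 'X + c%:P) ^+ 2.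
  by rewrite crdyy /crdX -!rmorphM -rmorphXn -rmorphD -eq_q.
set l := crdy q - _.
have YR : crdY q R = l + kc m * crdX q R.
  by rewrite crdYE crdXE /l R2 /kc !(rmorphD, rmorphM) /=; ring.
have YS : crdY q S = l + kc m * crdX q S.
  by rewrite crdYE crdXE /l S2 /kc !(rmorphD, rmorphM) /=; ring.
have YT : crdY q (oppc T) = l + kc m * crdX q T.
  by rewrite crdYE crdXE /l /= T2 opprK /kc !(rmorphD, rmorphM) /=; ring.
have XX : van [:: R; S] (crdX q R * crdX q S).
  by rewrite -[X in _ * X]mulr1; do 2![apply: vanX].
have Xl : van [:: R; S] (crdX q R * l).
  have -> : crdX q R * l = crdX q R * crdY q S - kc m * (crdX q R * crdX q S).
    by rewrite YS; ring.
  apply: vanB; last exact: vanMl.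
  by rewrite -[crdY q _]mulr1; apply: vanX; apply: vanY.
have lX : van [:: R; S] (crdX q S * l).
  have -> : crdX q S * l = crdY q R * crdX q S - kc m * (crdX q R * crdX q S).
    by rewrite YR; ring.
  apply: vanB; last exact: vanMl.
  by rewrite -[crdX q _]mulr1; apply: vanY; apply: vanX.
have ll : van [:: R; S] (l * l).
  have -> : l * l = crdY q R * crdY q S - kc m * (crdX q R * l) - kc m * (crdX q S * l)
     - kc m ^+ 2 * (crdX q R * crdX q S) by rewrite YR YS; ring.
  do ![apply: vanB]; try exact: vanMl.
  by rewrite -[crdY q S]mulr1; apply: vanY; apply: vanY.
have l2 : van [:: R; S] l.
  (* When the abscissas agree the line is tangent at [R], and [2 * R.2] replaces their difference as
     the invertible constant. *)
  have [e|ne] := eqVneq R.1 S.1; last first.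
    apply: (@van_scal (S.1 - R.1)); first by rewrite subr_eq0 eq_sym.
    have -> : kc (S.1 - R.1) * l = crdX q R * l - crdX q S * l.
      by rewrite !crdXE /kc polyCB rmorphB /=; ring.
    exact: vanB.
  have R20 : R.2 != 0 by move: dist; rewrite e eqxx.
  apply: (@van_scal (2 * R.2)); first by rewrite mulf_neq0.
  have -> : kc (2 * R.2) * l = crdX q T * (crdX q R * crdX q S) - l * l
      - kc (2 * m) * (crdX q R * l).
    have -> : l * l = crdy q * crdy q - 2 * crdp q (m%:P * 'X + c%:P) * l
       - crdp q (m%:P * 'X + c%:P) ^+ 2 by rewrite /l; ring.
    rewrite yy R2 crdXE /kc !(polyCD, polyCM) !(rmorphD, rmorphM) /= !rmorph1.
    by ring.
  by apply: vanB; [apply: vanB => // |]; apply: vanMl.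
(* [w] is the cofactor in [l * crdY q T = crdX q T * w], through which the third ideal is reached
   from the first two. *)
set w := crdX q R * crdX q S - kc m * l.
have hw : van [:: R; S] w by apply: vanB => //; apply: vanMl.
have lY : l * crdY q T = crdX q T * w.
  rewrite /w; have -> : crdY q T = crdy q + crdp q (m%:P * 'X + c%:P) - kc m * crdX q T.
    by rewrite crdYE crdXE T2 /kc !(rmorphN, rmorphD, rmorphM) /=; ring.
  transitivity (crdy q * crdy q - crdp q (m%:P * 'X + c%:P) ^+ 2 - kc m * crdX q T * l).
    by rewrite /l; ring.
  by rewrite yy; ring.
apply: (@van_perm _ _ [:: oppc T; R; S]).
  exact: permEl (perm_catC [:: oppc T] [:: R; S]).
set s := [:: _; R; S].
have Xv f : van [:: R; S] f -> van s (crdX q T * f).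
  by move=> hf; apply: (@vanX _ _ (oppc T)).
have Yv f : van [:: R; S] f -> van s (crdY q (oppc T) * f).
  by move=> hf; apply: vanY.
have [T20|T20] := eqVneq T.2 0; last first.
  apply: (@van_scal (- (2 * T.2))); first by rewrite oppr_eq0 mulf_neq0.
  have -> : kc (- (2 * T.2)) * l = crdX q T * w - crdY q (oppc T) * l.
    by rewrite -lY !crdYE /kc /= !(polyCN, polyCM) !(rmorphN, rmorphM) /= ?rmorph1; ring.
  by apply: vanB; [exact: Xv | exact: Yv].
have lv f : van [:: R; S] f -> van s (l * f).
  move=> hf; have -> : l * f = crdY q (oppc T) * f - kc m * (crdX q T * f).
    by rewrite YT; ring.
  by apply: vanB; [exact: Yv | apply: vanMl; exact: Xv].
have mt : m * T.1 + c = 0 by apply/eqP; rewrite -oppr_eq0 -T2 T20.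
(* Now [T.1] is a root of [q], simple by smoothness, so it differs from [R.1] and [S.1]. *)
have : q^`().[T.1] != 0.
  apply: smooth; rewrite eq_q !(hornerD, hornerM, hornerC, hornerX, hornerN, horner_exp).
  by rewrite mt; ring.
have -> : q^`().[T.1] = (T.1 - R.1) * (T.1 - S.1).
  rewrite eq_q !(expr2, derivD, derivM, derivC, derivX, derivN).
  rewrite !(hornerD, hornerM, hornerC, hornerX, hornerN).
  by rewrite mt; ring.
move=> n0; apply: (van_scal n0).
have -> : kc ((T.1 - R.1) * (T.1 - S.1)) * l = l * w + kc m * (l * l)
    - (crdp q 'X + kc T.1 - kc R.1 - kc S.1) * (crdX q T * l).
  rewrite /w !crdXE /kc !(polyCB, polyCM) !(rmorphB, rmorphM) /=; ring.
by apply: vanB; [apply: vanD; [|apply: vanMl]; apply: lv | apply: vanMl; apply: Xv].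
Qed.

Lemma sz_line (m c : K) : sz (crdy q - crdp q (m%:P * 'X + c%:P)) = 4%N.
Proof.
have sL : (size (m%:P * 'X + c%:P)%R <= 2)%N.
  rewrite (leq_trans (size_polyD _ _)) // geq_max mul_polyC.
  rewrite (leq_trans (size_scale_leq _ _)) ?size_polyX //=.
  exact: leq_trans (size_polyC_leq1 _) _.
rewrite szE // !crd_coord /= oppr0 addr0 add0r size_polyN oner_eq0 size_poly1.
by size_lia.
Qed.

End Lines.

(** * The group of points *)

Definition cpt (K : fieldType) (E : smooth_curve K) : Type :=
  {P : point K | on_curve E P}.

HB.instance Definition _ (K : fieldType) (E : smooth_curve K) :=
  Choice.copy (cpt E) {P : option (K * K) | on_curve E P}.

Section Group.
Variables (K : fieldType) (E : smooth_curve K).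
Implicit Types (P Q R : cpt E) (s t : seq (cpt E)).

Let two0 := two_neq0 E.
Let q := cubic E.
Let szq : size q = 4%N := size_cubic E.
Let smooth r : q.[r] = 0 -> q^`().[r] != 0.
Proof. exact: cubic_smooth two0 _ (wei_elliptic E). Qed.

Definition cpt0 : cpt E := exist (fun P : point K => on_curve E P) None isT.

Definition affine P : bool := sval P != None.
(** The point at infinity gets a dummy value; [pts] discards it, since the behaviour at infinity is
    measured by [sz]. *)
Definition cc P : K * K := if sval P is Some T then sqc E T else 0.
Definition pts s : seq (K * K) := [seq cc P | P <- s & affine P].

Lemma affineP P : reflect (P <> cpt0) (affine P).
Proof.
apply: (iffP idP); first by move=> + e; rewrite e.
by move=> h; apply/eqP => e; apply: h; apply: val_inj.
Qed.

Lemma affine_neq P : affine P = (P != cpt0).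
Proof. by apply/affineP/idP => /eqP. Qed.

Lemma cc_inj P Q : affine P -> affine Q -> cc P = cc Q -> P = Q.
Proof.
case: P Q => [[[x y]|] hP] [[[x' y']|] hQ] //= _ _; rewrite /cc /sqc /=.
by case=> ex ey; apply: val_inj; rewrite /= ex; move: ey; rewrite ex => /addIr/addIr ->.
Qed.

Lemma onc_cc P : affine P -> onc q (cc P).
Proof. by case: P => [[[x y]|] hP] // _; rewrite /cc /= -on_curveE. Qed.

Definition opp_point (P : point K) : point K :=
  if P is Some (x, y) then Some (x, - y - wa1 E * x - wa3 E) else None.

Lemma sqc_opp x y : sqc E (x, - y - wa1 E * x - wa3 E) = oppc (sqc E (x, y)).
Proof. by rewrite /sqc /oppc /= wa1E // wa3E //; congr pair; ring. Qed.

Fact opp_on_curve P : on_curve E (opp_point (sval P)).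
Proof.
case: P => [[[x y]|] hP] //=; rewrite -[_ == _]/(on_curve E (Some (x, _))).
by move: hP; rewrite !on_curveE // sqc_opp /onc /= sqrrN.
Qed.
Definition oppt P : cpt E := exist (fun P : point K => on_curve E P) _ (opp_on_curve P).

Lemma cc_opp P : affine P -> cc (oppt P) = oppc (cc P).
Proof. by case: P => [[[x y]|] hP] //= _; rewrite /cc /= sqc_opp. Qed.
Lemma affine_opp P : affine (oppt P) = affine P.
Proof. by case: P => [[[x y]|] hP]. Qed.
Lemma opptK : involutive oppt.
Proof.
case=> [[[x y]|] hP]; apply: val_inj => //=; congr (Some (_, _)); ring.
Qed.

Lemma opp_eqE x1 y1 x2 y2 : Some (x2, y2) = opp_point (Some (x1, y1)) <->
  (x1 == x2) && (y1 + y2 + wa1 E * x2 + wa3 E == 0).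
Proof.
rewrite /=; split=> [[-> ->]|/andP[/eqP -> /eqP h]].
  by rewrite eqxx; apply/eqP; ring.
by congr (Some (_, _)); apply/eqP; rewrite -subr_eq0 -h; apply/eqP; ring.
Qed.

Fact add_on_curve P Q : on_curve E (add_point E (sval P) (sval Q)).
Proof.
case: P Q => [[[x1 y1]|] hP] [[[x2 y2]|] hQ]; [ | exact: hP | exact: hQ | by []].
rewrite -[sval _]/(Some (x1, y1)) -[sval _]/(Some (x2, y2)).
have [e|ne] := boolP ((x1 == x2) && (y1 + y2 + wa1 E * x2 + wa3 E == 0)).
  by rewrite /add_point e.
have [m [c [[x y] [-> [eq_q _ _ hT _]]]]] := add_collinear two0 hP hQ ne.
rewrite on_curveE // /onc hT eq_q.
by rewrite !(hornerD, hornerM, hornerN, hornerC, hornerX, horner_exp) /=; apply/eqP; ring.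
Qed.
Definition addt P Q : cpt E := exist (fun P : point K => on_curve E P) _ (add_on_curve P Q).

Lemma addt0 P : addt P cpt0 = P.
Proof. by apply: val_inj; case: P => [[[x y]|] hP]. Qed.
Lemma add0t P : addt cpt0 P = P.
Proof. by apply: val_inj. Qed.

Lemma addt_eq0 P Q : addt P Q = cpt0 <-> Q = oppt P.
Proof.
split=> [/(congr1 sval)|->].
  case: P Q => [[[x1 y1]|] hP] [[[x2 y2]|] hQ] //= h; apply: val_inj => //=.
  by apply/opp_eqE; move: h; case: ifP.
apply: val_inj => /=; case: P => [[[x1 y1]|] hP] //=.
have /opp_eqE -> : Some (x1, - y1 - wa1 E * x1 - wa3 E) = opp_point (Some (x1, y1)) by [].
by [].
Qed.

Lemma addt_collinear P Q : affine P -> affine Q -> Q <> oppt P ->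
  affine (addt P Q) /\ exists m c, collinear E m c (cc P) (cc Q) (cc (addt P Q)).
Proof.
move=> aP aQ ne; split; first by apply/affineP => /addt_eq0.
case: P Q aP aQ ne => [[[x1 y1]|] hP] [[[x2 y2]|] hQ] //= _ _ ne.
have no : ~~ ((x1 == x2) && (y1 + y2 + wa1 E * x2 + wa3 E == 0)).
  by apply/negP => /opp_eqE h; apply: ne; apply: val_inj.
have [m [c [T [hT col]]]] := add_collinear two0 hP hQ no.
by exists m, c; rewrite /cc -[sval (addt _ _)]/(add_point E (Some (x1, y1)) (Some (x2, y2))) hT.
Qed.

(* [s] minus [size s] times the point at infinity is a principal divisor. *)
Definition princ s : Prop :=
  exists f : crd q, [/\ f != 0, van (pts s) f & (sz f <= (size (pts s)).+1)%N].

Lemma pts_cat s t : pts (s ++ t) = pts s ++ pts t.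
Proof. by rewrite /pts filter_cat map_cat. Qed.
Lemma pts_cons P s : pts (P :: s) = if affine P then cc P :: pts s else pts s.
Proof. by rewrite /pts /=; case: ifP. Qed.
Lemma pts_opp s : pts (map oppt s) = map (@oppc K) (pts s).
Proof.
elim: s => //= P s ih; rewrite !pts_cons affine_opp.
by case: ifP => //= aP; rewrite ih cc_opp.
Qed.
Lemma onc_pts s : all (onc q) (pts s).
Proof. by elim: s => //= P s ih; rewrite pts_cons; case: ifP => //= /onc_cc ->. Qed.

Lemma eq_princ s t : pts s = pts t -> princ s -> princ t.
Proof. by rewrite /princ => ->. Qed.

Lemma princ_perm s t : perm_eq s t -> princ s -> princ t.
Proof.
move=> pst [f [f0 hf sf]]; have p' : perm_eq (pts s) (pts t).
  by apply: perm_map; apply: perm_filter.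
by exists f; split=> //; [exact: van_perm hf | rewrite -(perm_size p')].
Qed.

Lemma princ_cat s t : princ s -> princ t -> princ (s ++ t).
Proof.
move=> [f [f0 hf sf]] [g [g0 hg sg]]; exists (f * g); split.
- by rewrite crd_mul_eq0 // negb_or f0.
- by rewrite pts_cat; exact: van_catM.
- rewrite szM // (negPf f0) (negPf g0) pts_cat size_cat /=.
  by move: f0; rewrite -(sz_eq0 szq) => f0; lia.
Qed.

Lemma princ_opp s : princ s -> princ (map oppt s).
Proof.
move=> [f [f0 hf sf]]; exists (conjc f); split.
- by rewrite -(sz_eq0 szq) sz_conjc sz_eq0.
- by rewrite pts_opp; exact: van_conjc.
- by rewrite pts_opp size_map sz_conjc.
Qed.

Lemma princ_vertical P : princ [:: P; oppt P].
Proof.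
have [aP|aP] := boolP (affine P); last first.
  exists 1; rewrite /pts /= affine_opp (negPf aP) oner_eq0; split=> //.
  by rewrite sz1.
exists (crdX q (cc P)); rewrite /pts /= affine_opp aP crdX_neq0 // sz_crdX //=.
by split=> //; rewrite cc_opp //; apply: van_vertical => //; exact: onc_cc.
Qed.

Lemma princ_cancel P s : princ [:: P, oppt P & s] -> princ s.
Proof.
move=> [f [f0 hf sf]]; have [aP|aP] := boolP (affine P); last first.
  by exists f; move: hf sf; rewrite !pts_cons affine_opp (negPf aP).
move: hf sf; rewrite !pts_cons affine_opp aP cc_opp // => hf sf.
have [f' hf' ef] := van_cancel (onc_cc aP) hf.
have f'0 : f' != 0 by apply: contraNneq f0 => e; rewrite ef e mulr0.
exists f'; split=> //; move: sf; rewrite ef szM // (negPf f'0) (negPf (crdX_neq0 szq _)).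
by rewrite sz_crdX // /=; lia.
Qed.

Lemma princ_line P Q : princ [:: P; Q; oppt (addt P Q)].
Proof.
have [aP|] := boolP (affine P); last first.
  rewrite affine_neq negbK => /eqP ->; rewrite add0t.
  by apply: eq_princ (princ_vertical Q); rewrite !pts_cons.
have [aQ|] := boolP (affine Q); last first.
  rewrite affine_neq negbK => /eqP ->; rewrite addt0.
  by apply: eq_princ (princ_vertical P); rewrite !pts_cons.
have [->|nPQ] := eqVneq Q (oppt P).
  have -> : addt P (oppt P) = cpt0 by apply/addt_eq0.
  by apply: eq_princ (princ_vertical P); rewrite !pts_cons.
have [aT [m [c [eq_q R2 S2 T2 d]]]] := addt_collinear aP aQ (elimN eqP nPQ).
exists (crdy q - crdp q (m%:P * 'X + c%:P)); rewrite -(sz_eq0 szq) sz_line //.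
rewrite !pts_cons affine_opp aP aQ aT cc_opp //; split=> //.
exact: van_line.
Qed.

(** Concatenation with the divisor of the line through [P] and [Q], or with its conjugate, produces
    pairs of opposite points, which [princ_cancel] removes. *)
Lemma princ_add P Q s : princ [:: P, Q & s] <-> princ (addt P Q :: s).
Proof.
split=> h; last first.
  apply: (@princ_cancel (addt P Q)); have := princ_cat (princ_line P Q) h.
  apply: princ_perm; apply/seq.permP => a /=; lia.
have := princ_cat (princ_opp (princ_line P Q)) h.
rewrite /= opptK => h'; apply: (@princ_cancel P); apply: (@princ_cancel Q).
by apply: princ_perm h'; apply/seq.permP => a /=; lia.
Qed.

Lemma princ1 P : princ [:: P] -> P = cpt0.
Proof.
move=> [f [f0 hf sf]]; apply/eqP/negPn; rewrite -affine_neq; apply/negP => aP.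
move: hf sf; rewrite pts_cons aP => hf sf.
have := van_sz szq _ hf f0; have := sz_neq2 szq f; rewrite /= onc_cc // => h1 /(_ isT).
by move: sf h1; rewrite /=; lia.
Qed.

Lemma princ_nil : princ [::].
Proof.
by exists 1; rewrite oner_eq0; split=> //; rewrite sz1.
Qed.

(** The sum is a left fold because associativity is not yet available; it is deduced from this
    statement. *)
Lemma princ_cons P s : princ (P :: s) <-> foldl addt P s = cpt0.
Proof.
elim: s P => [|Q s ih] P /=; last by rewrite princ_add.
by split=> [/princ1 //|->]; apply: eq_princ princ_nil.
Qed.

Fact addtC : commutative addt.
Proof.
move=> P Q; have : princ [:: Q; P; oppt (addt P Q)].
  by apply: princ_perm (princ_line P Q); apply/seq.permP => a /=; lia.
move=> /princ_cons /= /addt_eq0 /(congr1 oppt); by rewrite !opptK.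
Qed.

(** Principality does not depend on the order of the points, so the same point completes [P], [Q],
    [R] to a principal divisor for both bracketings. *)
Fact addtA : associative addt.
Proof.
move=> P Q R; rewrite (addtC P); set U := addt (addt P Q) R.
have : princ [:: P; Q; R; oppt U] by apply/princ_cons => /=; apply/addt_eq0.
move=> /(@princ_perm _ [:: Q; R; P; oppt U]) h.
have /h : perm_eq [:: P; Q; R; oppt U] [:: Q; R; P; oppt U] by apply/seq.permP => a /=; lia.
by move=> /princ_cons /= /addt_eq0 /(congr1 oppt); rewrite !opptK.
Qed.

Fact addNt : left_inverse cpt0 oppt addt.
Proof. by move=> P; rewrite addtC; apply/addt_eq0. Qed.

HB.instance Definition _ := GRing.isZmodule.Build (cpt E) addtA addtC add0t addNt.

Lemma sval_add P Q : sval (P + Q) = add_point E (sval P) (sval Q).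
Proof. by []. Qed.

Lemma princP s : princ s <-> \sum_(P <- s) P = 0.
Proof.
have e P : foldl addt P s = P + \sum_(Q <- s) Q.
  elim: s P => [|Q s ih] P /=; first by rewrite big_nil addr0.
  by rewrite big_cons ih addrA.
rewrite -[\sum_(_ <- _) _]add0r -e -princ_cons.
by split; apply: eq_princ; rewrite pts_cons.
Qed.

Lemma sval_muln n P : muln_point E n (sval P) = sval (P *+ n).
Proof.
elim: n => [|n ih]; first by [].
by rewrite mulrS sval_add -ih.
Qed.

End Group.

(** * Base change *)

Section BaseChange.
Variables (K K' : fieldType) (phi : {rmorphism K -> K'}).

Definition map_point (P : point K) : point K' :=
  if P is Some (x, y) then Some (phi x, phi y) else None.

Lemma map_point_inj : injective map_point.
Proof. by move=> [[x y]|] [[x' y']|] //= [/fmorph_inj -> /fmorph_inj ->]. Qed.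

Lemma map_add_point E P Q :
  add_point (map_weierstrass phi E) (map_point P) (map_point Q)
  = map_point (add_point E P Q).
Proof.
case: P Q => [[x1 y1]|] [[x2 y2]|] //=.
rewrite (inj_eq (fmorph_inj phi)) -!rmorphM -!rmorphD fmorph_eq0.
case: ifP => // _; set l := if _ then _ else _; set l' := if _ then _ else _.
have -> : l = phi l'.
  rewrite /l /l'; case: ifP => _;
    by rewrite !(rmorph_nat, rmorphXn, fmorphV, rmorphB, rmorphD, rmorphM).
by rewrite /= !(rmorphXn, rmorphB, rmorphN, rmorphD, rmorphM).
Qed.

Lemma map_on_curve E P :
  on_curve (map_weierstrass phi E) (map_point P) = on_curve E P.
Proof.
case: P => [[x y]|] //=.
by rewrite -(inj_eq (fmorph_inj phi)) !(rmorphXn, rmorphD, rmorphM).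
Qed.

Lemma map_elliptic E : elliptic (map_weierstrass phi E) = elliptic E.
Proof.
rewrite /elliptic -(fmorph_eq0 phi) /discriminant; case: E => a1 a2 a3 a4 a6 /=.
by rewrite !(rmorph_nat, rmorphXn, rmorphB, rmorphN, rmorphD, rmorphM).
Qed.

Lemma map_muln_point E n P :
  muln_point (map_weierstrass phi E) n (map_point P) = map_point (muln_point E n P).
Proof.
by elim: n => //= n ih; rewrite -map_add_point -ih.
Qed.

Variable E : smooth_curve K.

Fact map_two_neq0 : (2 : K') != 0.
Proof. by rewrite -(rmorph_nat phi) fmorph_eq0 two_neq0. Qed.
Fact map_wei_elliptic : elliptic (map_weierstrass phi E).
Proof. by rewrite map_elliptic wei_elliptic. Qed.
(** Functions will be constructed over [K] but compared along the orbit of a 2-torsion point, which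
    may exist only over an extension [K']. *)
Definition map_curve : smooth_curve K' := SmoothCurve map_two_neq0 map_wei_elliptic.

Fact map_cpt_subproof (P : cpt E) : on_curve map_curve (map_point (sval P)).
Proof. by rewrite map_on_curve; case: P. Qed.
Definition map_cpt (P : cpt E) : cpt map_curve :=
  exist (fun P : point K' => on_curve map_curve P) _ (map_cpt_subproof P).

Lemma map_cpt_inj : injective map_cpt.
Proof. by move=> P Q /(congr1 sval)/map_point_inj/val_inj. Qed.

Lemma map_cptD : {morph map_cpt : P Q / P + Q}.
Proof. by move=> P Q; apply: val_inj; exact: esym (map_add_point _ _ _). Qed.

Fact map_cpt_zmod : zmod_morphism map_cpt.
Proof.
have m0 : map_cpt 0 = 0 by apply: (addIr (map_cpt 0)); rewrite -map_cptD !add0r.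
have mN P : map_cpt (- P) = - map_cpt P.
  by apply: (addIr (map_cpt P)); rewrite -map_cptD !addNr.
by move=> P Q; rewrite map_cptD mN.
Qed.
HB.instance Definition _ := GRing.isZmodMorphism.Build _ _ map_cpt map_cpt_zmod.

Lemma affine_map P : affine (map_cpt P) = affine P.
Proof. by case: P => [[[x y]|] hP]. Qed.

Definition map_pair (P : K * K) : K' * K' := (phi P.1, phi P.2).

Lemma h1_map : h1 map_curve = phi (h1 E).
Proof. by rewrite /h1 /= rmorphM fmorphV rmorph_nat. Qed.
Lemma h3_map : h3 map_curve = phi (h3 E).
Proof. by rewrite /h3 /= rmorphM fmorphV rmorph_nat. Qed.

Lemma cc_map P : cc (map_cpt P) = map_pair (cc P).
Proof.
case: P => [[[x y]|] hP]; rewrite /cc /=; last by rewrite /map_pair /= rmorph0.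
by rewrite /sqc /map_pair /= h1_map h3_map !(rmorphD, rmorphM).
Qed.

Lemma pts_map s : pts (map map_cpt s) = map map_pair (pts s).
Proof.
elim: s => //= P s ih; rewrite !pts_cons affine_map ih.
by case: ifP => //= _; rewrite cc_map.
Qed.

Lemma cubic_map : cubic map_curve = map_poly phi (cubic E).
Proof.
rewrite /cubic h1_map h3_map /= !(rmorphXn, rmorphD, rmorphM) /= ?map_polyXn map_polyX.
by rewrite !map_polyC /= !rmorph1.
Qed.

Definition mapc (f : crd (cubic E)) : crd (cubic map_curve) :=
  (map_poly phi f.1, map_poly phi f.2).

Fact mapc_zmod : zmod_morphism mapc.
Proof. by move=> f g; apply: crd_eqP; rewrite !crd_coord /= ?crd_coord rmorphB. Qed.
Fact mapc_monoid : monoid_morphism mapc.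
Proof.
split=> [|f g]; apply: crd_eqP; rewrite /= ?crd_coord /= ?rmorph1 ?rmorph0 //=.
  by rewrite rmorphD !rmorphM /= cubic_map.
by rewrite rmorphD !rmorphM.
Qed.
HB.instance Definition _ := GRing.isZmodMorphism.Build _ _ mapc mapc_zmod.
HB.instance Definition _ := GRing.isMonoidMorphism.Build _ _ mapc mapc_monoid.

Lemma mapc_crdp a : mapc (crdp (cubic E) a) = crdp (cubic map_curve) (map_poly phi a).
Proof. by apply: crd_eqP; rewrite //= rmorph0. Qed.
Lemma mapc_crdy : mapc (crdy (cubic E)) = crdy (cubic map_curve).
Proof. by apply: crd_eqP; rewrite /= ?rmorph0 ?rmorph1. Qed.
Lemma mapc_crdX R : mapc (crdX (cubic E) R) = crdX (cubic map_curve) (map_pair R).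
Proof. by rewrite /crdX mapc_crdp rmorphB /= map_polyX map_polyC. Qed.
Lemma mapc_crdY R : mapc (crdY (cubic E) R) = crdY (cubic map_curve) (map_pair R).
Proof. by rewrite /crdY rmorphB /= mapc_crdp mapc_crdy map_polyC. Qed.

Lemma van_mapc s f : van s f -> van (map map_pair s) (mapc f).
Proof.
elim: s f => //= R s ih f [f1 [f2 [/ih h1 /ih h2 ->]]].
by exists (mapc f1), (mapc f2); rewrite rmorphD !rmorphM /= mapc_crdX mapc_crdY.
Qed.

Lemma sz_mapc f : sz (mapc f) = sz f.
Proof.
rewrite /sz -(size_map_poly phi) /nrm /= cubic_map.
by rewrite rmorphB rmorphXn rmorphM rmorphXn.
Qed.

Lemma mapc_eq0 f : (mapc f == 0) = (f == 0).
Proof. by rewrite -!sz_eq0 ?sz_mapc //; exact: size_cubic. Qed.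

Lemma ev_mapc R f : ev (map_pair R) (mapc f) = phi (ev R f).
Proof. by rewrite /ev /= !horner_map rmorphD rmorphM. Qed.

End BaseChange.

Arguments wei : simpl never.
Arguments map_cpt {K K'} phi {E} P.

(** * Translations *)

Section Coset.
Variables (V : zmodType) (p : nat) (Q : V).
Hypotheses (Qp : Q *+ p = 0).

Definition coset_seq (U : V) : seq V := [seq U + Q *+ j | j <- iota 0 p].

Lemma size_coset_seq U : size (coset_seq U) = p.
Proof. by rewrite size_map size_iota. Qed.

(** The multiples of [Q] add up to [p (p - 1) / 2] times [Q], and this coefficient is divisible by
    [p] for [p] odd. *)
Lemma sum_coset_seq U : odd p -> \sum_(S <- coset_seq U) S = U *+ p.
Proof.
move=> odd_p; have e : iota 0 p = index_iota 0 p by rewrite /index_iota subn0.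
rewrite big_map big_split /= e sumr_const_nat subn0 sumrMnr.
by rewrite bin2_sum bin2odd // mulrnA Qp mul0rn addr0.
Qed.

Lemma coset_seq_succ U S : S \in coset_seq U -> S + Q \in coset_seq U.
Proof.
move=> /mapP[j]; rewrite mem_iota add0n /= => ltj ->; rewrite -addrA -mulrSr.
move: (ltj); rewrite leq_eqVlt => /predU1P[ej|ltj1]; apply/mapP.
  by exists 0%N; rewrite ?mem_iota ?ej ?Qp //= add0n (leq_ltn_trans _ ltj).
by exists j.+1; rewrite ?mem_iota.
Qed.

Lemma mulrn_eq0_dvd n : prime p -> Q != 0 -> Q *+ n = 0 -> (p %| n)%N.
Proof.
move=> pr_p Q0 Qn; apply: contraT; rewrite -prime_coprime // coprime_sym.
have [->|n0] := posnP n; first by rewrite /coprime gcd0n; case: p pr_p => [|[|]].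
move=> /(coprimeP _ n0)[[u v] /= e]; case/eqP: Q0.
rewrite -[Q]mulr1n -e mulrnBr; last by lia.
by rewrite mulnC mulrnA Qn mul0rn mulnC mulrnA Qp mul0rn subrr.
Qed.

Lemma uniq_coset_seq U : prime p -> Q != 0 -> uniq (coset_seq U).
Proof.
move=> pr_p Q0; rewrite map_inj_in_uniq ?iota_uniq // => i j.
rewrite !mem_iota !add0n /= => lti ltj /addrI.
wlog leij : i j lti ltj / (i <= j)%N.
  by move=> h e; case: (leqP i j) => [|/ltnW] hij; [exact: h | rewrite (h j i)].
move=> e; have : Q *+ (j - i) = 0 by rewrite mulrnBr // e subrr.
move=> /(mulrn_eq0_dvd pr_p Q0) /dvdn_leq; lia.
Qed.

Lemma coset_seq_out U S (i : nat) :
  (forall i : nat, U <> Q *+ i) -> S \in coset_seq U -> S <> Q *+ i.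
Proof.
move=> out /mapP[j hj ->] e; apply: (out (i + p.-1 * j)%N).
have p0 : (0 < p)%N by move: hj; rewrite mem_iota; lia.
rewrite mulrnDr -e -addrA -mulrnDr -mulSn prednK //.
by rewrite mulrnA Qp mul0rn addr0.
Qed.

End Coset.

(** * Points at which a function does not vanish *)

Section NonVanishing.
Variables (K : fieldType) (E : smooth_curve K).
Let q := cubic E.
Let szq : size q = 4%N := size_cubic E.

Lemma cc_eq_fst (P Q : cpt E) : affine P -> affine Q -> (cc P).1 = (cc Q).1 ->
  P = Q \/ P = - Q.
Proof.
move=> aP aQ e; have /eqP yP := onc_cc aP; have /eqP yQ := onc_cc aQ.
move: yP; rewrite e -yQ => /eqP; rewrite eqf_sqr => /orP[]/eqP e2; [left|right].
  by apply: cc_inj => //; rewrite [LHS]surjective_pairing e e2 -surjective_pairing.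
by apply: cc_inj; rewrite ?affine_opp // cc_opp // [LHS]surjective_pairing e e2.
Qed.

Lemma mem_pts s (P : cpt E) : affine P -> (cc P \in pts s) = (P \in s).
Proof.
move=> aP; apply/mapP/idP => [[S]|Ps]; last by exists P; rewrite // mem_filter aP.
by rewrite mem_filter => /andP[aS Ss] /cc_inj ->.
Qed.

Lemma uniq_pts (s : seq (cpt E)) : uniq s -> uniq (pts s).
Proof.
move=> us; rewrite map_inj_in_uniq ?filter_uniq // => P Q.
by rewrite !mem_filter => /andP[aP _] /andP[aQ _]; exact: cc_inj.
Qed.

Lemma size_pts (s : seq (cpt E)) : all (@affine K E) s -> size (pts s) = size s.
Proof. by rewrite size_map => /all_filterP ->. Qed.

(** The zeros in [s] already account for the whole pole at infinity; one more would contradict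
    [van_sz]. *)
Lemma ev_neq0 s (f : crd q) (Z : cpt E) : f != 0 -> van (pts s) f ->
  (sz f <= (size (pts s)).+1)%N -> affine Z -> Z \notin s -> ev (cc Z) f != 0.
Proof.
move=> f0 hf sf aZ nZ; apply: contraTneq sf => e.
have hZ : van (cc Z :: pts s) f.
  by apply: van_add => //; [exact: onc_cc | rewrite mem_pts].
have := van_sz szq _ hZ f0; rewrite /= onc_cc // onc_pts => /(_ isT).
by rewrite -ltnNge.
Qed.

End NonVanishing.

Lemma van_cancel_nseq (K : fieldType) (q : {poly K}) n R s (f : crd q) : onc q R ->
  van (nseq n R ++ nseq n (oppc R) ++ s) f ->
  exists2 f', van s f' & f = crdX q R ^+ n * f'.
Proof.
move=> oR; elim: n f => [|n ih] f hf; first by exists f; rewrite // expr0 mul1r.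
have {}hf : van [:: R, oppc R & nseq n R ++ nseq n (oppc R) ++ s] f.
  apply: van_perm hf; apply/seq.permP => a.
  by rewrite /= !count_cat /= !count_cat !count_nseq /=; lia.
have [f1 /ih[f' hf' ->] ->] := van_cancel oR hf.
by exists f' => //; rewrite exprS mulrA.
Qed.

(** * Functions composed with a translation *)

Section Translation.
Variables (K K' : fieldType) (phi : {rmorphism K -> K'}) (E : smooth_curve K).
Variable (Q : cpt E).
Hypothesis aQ : affine Q.
Let q := cubic E.
Let szq : size q = 4%N := size_cubic E.
Let E' := map_curve phi E.
Let Q' : cpt E' := map_cpt phi Q.

(* [F] is [f] composed with the translation by [Q], with the poles of order at
   most [n] at [- Q] cleared by [(x - x(Q)) ^ n]. *)
Definition translate n (f F : crd q) : Prop :=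
  [/\ van (nseq n (cc Q)) F, (sz F <= (2 * n).+1)%N
    & forall Z : cpt E', affine Z -> Z <> Q' -> Z <> - Q' ->
        ev (cc Z) (mapc phi F) =
          ev (cc Z) (mapc phi (crdX q (cc Q))) ^+ n * ev (cc (Z + Q')) (mapc phi f)].

Lemma translateD n f g F G :
  translate n f F -> translate n g G -> translate n (f + g) (F + G).
Proof.
move=> [vF sF eF] [vG sG eG]; split.
- exact: vanD.
- exact: (szD szq).
by move=> Z aZ nZ nZ'; rewrite !rmorphD !evD /= eF // eG // [RHS]mulrDr.
Qed.

Lemma affine_trans (Z : cpt E') : affine Z -> Z <> - Q' -> affine (Z + Q').
Proof.
move=> aZ nZ; apply/affineP => /eqP; rewrite -[cpt0 _]/(0 : cpt E') addr_eq0.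
by move/eqP.
Qed.

Lemma translateM m n f g F G :
  translate m f F -> translate n g G -> translate (m + n) (f * g) (F * G).
Proof.
move=> [vF sF eF] [vG sG eG]; split.
- by rewrite nseqD; exact: van_catM.
- by rewrite szM //; case: ifP => _ //; lia.
- move=> Z aZ nZ nZ'; have oW := onc_cc (affine_trans aZ nZ').
  rewrite !rmorphM /= [LHS](evM _ _ (onc_cc aZ)) (evM _ _ oW).
  by rewrite eF // eG // exprD; ring.
Qed.

Lemma translate_const c : translate 0 (crdp q c%:P) (crdp q c%:P).
Proof.
split=> //; first by rewrite sz_crdp //; have := size_polyC_leq1 c; size_lia.
by move=> Z aZ nZ nZ'; rewrite expr0 mul1r !mapc_crdp !ev_crdp map_polyC !hornerC.
Qed.

Lemma translate1 : translate 1 1 (crdX q (cc Q)).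
Proof.
split.
- by rewrite -[crdX _ _]mulr1; apply: (@vanX _ _ _ [::]).
- by rewrite sz_crdX.
- by move=> Z aZ nZ nZ'; rewrite rmorph1 ev1 mulr1.
Qed.

Lemma translate_pole n f F : translate n f F -> exists G, translate n.+1 f G.
Proof.
by move=> h; have := translateM translate1 h; rewrite mul1r; exists (crdX q (cc Q) * F).
Qed.

Let xQ := (cc Q).1.
Let yQ := (cc Q).2.
Let a2 := wa2 E + h1 E ^+ 2.
Let a4 := wa4 E + 2 * h1 E * h3 E.
Let a6 := wa6 E + h3 E ^+ 2.

(* [(x(Z + Q) - x(Q)) (x - x(Q)) ^ 2] as a function of [Z = (x, y)]. *)
Let D : crd q := crdY q (cc Q) ^+ 2
  - crdp q ('X + (a2 + 2 * xQ)%:P) * crdX q (cc Q) ^+ 2.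

Lemma van_D : van [:: cc Q; cc Q] D.
Proof.
apply: vanB; rewrite ?expr2; last apply: vanMl.
  by rewrite -[X in _ * X]mulr1; do 2![apply: vanY].
by rewrite -[X in _ * X]mulr1; do 2![apply: vanX].
Qed.

(** Once [y ^ 2] is replaced by the cubic, the terms in [x ^ 3] and [x ^ 2] cancel; what is left is
    linear in [x] plus a multiple of [y]. *)
Lemma sz_D : (sz D <= 4)%N.
Proof.
have -> : D = crdp q ((a4 - xQ ^+ 2 + 2 * xQ * (a2 + 2 * xQ))%:P * 'X
    + (a6 + yQ ^+ 2 - (a2 + 2 * xQ) * xQ ^+ 2)%:P) - crdp q (2 * yQ)%:P * crdy q.
  have yy : crdy q * crdy q = crdp q ('X^3 + a2%:P * 'X^2 + a4%:P * 'X + a6%:P) :=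
    crdyy q.
  rewrite /D /crdX /crdY -/xQ -/yQ.
  transitivity (crdy q * crdy q - 2 * crdp q yQ%:P * crdy q + crdp q yQ%:P ^+ 2 -
    crdp q ('X + (a2 + 2 * xQ)%:P) * crdp q ('X - xQ%:P) ^+ 2); first ring.
  by rewrite yy; ring.
set u := _ + _%:P; set w := _%:P.
have -> : crdp q u - crdp q w * crdy q = ((u, - w) : crd q).
  by apply: crd_eqP; rewrite !crd_coord /=; ring.
rewrite szE //= size_polyN; have : (size u <= 2)%N.
  rewrite (leq_trans (size_polyD _ _)) // geq_max mul_polyC.
  rewrite (leq_trans (size_scale_leq _ _)) ?size_polyX //=.
  exact: leq_trans (size_polyC_leq1 _) _.
have := size_polyC_leq1 (2 * yQ); case: eqP => _; size_lia.
Qed.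

(** On the chord of slope [m] the difference of ordinates is [m * dx], and [collinear_sum_fst] gives
    the abscissa of the sum. The second identity multiplies the first by this difference and
    evaluates the line at the abscissa of the sum. *)
Lemma ev_D (Z : cpt E') : affine Z -> Z <> Q' -> Z <> - Q' ->
  let dx := (cc Z).1 - (cc Q').1 in
  ev (cc Z) (mapc phi D) = dx ^+ 2 * ((cc (Z + Q')).1 - (cc Q').1) /\
  ((cc Z).2 - (cc Q').2) * ev (cc Z) (mapc phi D) + (cc Q').2 * dx ^+ 3
    = - (dx ^+ 3 * (cc (Z + Q')).2).
Proof.
move=> aZ nZ nZ' dx; have aQ' : affine Q' by rewrite affine_map.
have nZ2 : Q' <> oppt Z by move=> e; apply: nZ'; rewrite e -[oppt Z]/(- Z) opprK.
have [_ [m [c col]]] := addt_collinear aZ aQ' nZ2.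
have := collinear_sum_fst col; case: col => _ Z2 Q2 T2 _.
rewrite -[addt Z Q']/(Z + Q') in T2 *; rewrite h1_map.
have -> : wa2 E' = phi (wa2 E) by [].
rewrite -rmorphXn -rmorphD -/a2 => eA.
have eD : ev (cc Z) (mapc phi D) = ((cc Z).2 - (cc Q').2) ^+ 2
    - ((cc Z).1 + phi a2 + 2 * (cc Q').1) * dx ^+ 2.
  rewrite /D rmorphB rmorphXn rmorphM rmorphXn /= mapc_crdX mapc_crdY mapc_crdp -cc_map.
  rewrite -/E' evB !expr2 !evM ?onc_cc // ev_crdX ev_crdY ev_crdp rmorphD /= map_polyX map_polyC.
  rewrite !hornerE /= rmorphD rmorphM rmorph_nat.
  by have -> : phi xQ = (cc Q').1; [rewrite cc_map | rewrite /dx; ring].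
have {}eD : ev (cc Z) (mapc phi D) = dx ^+ 2 * ((cc (Z + Q')).1 - (cc Q').1).
  by rewrite eD eA Z2 Q2 /dx; ring.
by split=> //; rewrite eD T2 Z2 Q2 /dx; ring.
Qed.

Lemma translate_x : translate 2 (crdp q 'X) (D + crdp q xQ%:P * crdX q (cc Q) ^+ 2).
Proof.
split.
- apply: vanD; first exact: van_D.
  by apply: vanMl; rewrite expr2 -[X in _ * X]mulr1; do 2![apply: vanX].
- apply: (szD szq) => //; first exact: leq_trans sz_D _.
  by rewrite (leq_trans (sz_scale _ _)) // sz_crdXn.
move=> Z aZ nZ nZ'; have [e _] := ev_D aZ nZ nZ'.
rewrite rmorphD rmorphM rmorphXn /= evD e mapc_crdX -cc_map !mapc_crdp expr2 !evM ?onc_cc //.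
rewrite !ev_crdX !ev_crdp map_polyC map_polyX !hornerE /=.
by have -> : phi xQ = (cc Q').1; [rewrite cc_map | ring].
Qed.

Lemma translate_y : translate 3 (crdy q)
  (- (crdY q (cc Q) * D + crdp q yQ%:P * crdX q (cc Q) ^+ 3)).
Proof.
split.
- apply: vanN; apply: vanD; first by apply: vanY; exact: van_D.
  by apply: vanMl; rewrite !exprS expr0; do 3![apply: vanX].
- rewrite szN; apply: (szD szq) => //.
    by have := sz_D; rewrite szM // sz_crdY //; case: ifP => // _; lia.
  by rewrite (leq_trans (sz_scale _ _)) // sz_crdXn.
move=> Z aZ nZ nZ'; have [_ e] := ev_D aZ nZ nZ'.
rewrite rmorphN rmorphD !rmorphM /= evN evD.
rewrite mapc_crdX mapc_crdY -cc_map mapc_crdp mapc_crdy !exprS !expr0 !mulr1 !evM ?onc_cc //.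
rewrite ev_crdX ev_crdY ev_crdp map_polyC hornerC /=.
have -> : ev (cc (Z + Q')) (crdy (cubic E')) = (cc (Z + Q')).2.
  by rewrite /ev /= !hornerE.
have -> : phi yQ = (cc Q').2 by rewrite cc_map.
by rewrite -/Q'; move: e; rewrite !exprS !expr0 !mulr1 => ->; rewrite opprK.
Qed.

(** Polynomials in [x] are built by Horner's scheme and combined with [y]. The clearing exponents 2
    for [x] and 3 for [y] equal their pole orders at infinity, so a pole of order at most [n] needs
    only the exponent [n]. *)
Lemma translate_exists n f : (sz f <= n.+1)%N -> exists F, translate n f F.
Proof.
have const m c : exists F, translate m (crdp q c%:P) F.
  elim: m => [|m [F hF]]; first by exists (crdp q c%:P); exact: translate_const.
  exact: translate_pole hF.
have polys (a : {poly K}) : forall m, (2 * size a <= m.+2)%N ->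
    exists F, translate m (crdp q a) F.
  elim/poly_ind: a => [m _|a c ih m]; first by rewrite -polyC0; exact: const.
  rewrite size_MXaddC; case: ifP => [/andP[/eqP -> _] _|].
    by rewrite mul0r add0r; exact: const.
  have [->|a0] := eqVneq a 0; first by rewrite mul0r add0r; move=> *; exact: const.
  rewrite -size_poly_gt0 in a0; move=> _ h.
  have [|F hF] := ih (m - 2)%N; first lia.
  have [G hG] := const m c.
  exists (F * (D + crdp q xQ%:P * crdX q (cc Q) ^+ 2) + G).
  rewrite rmorphD rmorphM; apply: translateD => //.
  have -> : m = (m - 2 + 2)%N by lia.
  exact: translateM hF translate_x.
rewrite szE // [f in translate _ f]crdE => h.
have [|F hF] := polys f.1 n; first by move: h; size_lia.
have [f20|f20] := eqVneq f.2 0.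
  by exists F; rewrite f20 rmorph0 mul0r addr0.
rewrite (negPf f20) in h; have s0 : (0 < size f.2)%N by rewrite size_poly_gt0.
have [|G hG] := polys f.2 (n - 3)%N; first by move: h s0; size_lia.
eexists; apply: translateD; first exact: hF.
have -> : n = (n - 3 + 3)%N by move: h s0; size_lia.
exact: translateM hG translate_y.
Qed.

End Translation.

(** * Functions with zeros along a coset *)

Section Eigenfunction.
Variables (K K' : fieldType) (phi : {rmorphism K -> K'}) (E : smooth_curve K).
Variables (p : nat) (Q : cpt E) (k : crd (cubic E)).
Hypotheses (pr_p : prime p) (odd_p : odd p) (Q0 : Q != 0) (Qp : Q *+ p = 0).
Hypothesis vk : van (pts (nseq p (- Q))) k.
Hypothesis sk : (sz k <= p.+1)%N.
Let q := cubic E.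
Let szq : size q = 4%N := size_cubic E.
Let E' := map_curve phi E.
Let Q' : cpt E' := map_cpt phi Q.

Let aQ : affine Q. Proof. by rewrite affine_neq. Qed.

Lemma affine_out (P : cpt E) : (forall i : nat, P <> Q *+ i) -> affine P.
Proof. by move=> out; apply/affineP; apply: (out 0%N). Qed.

Lemma coset_affine P : (forall i : nat, P <> Q *+ i) -> all (@affine K E) (coset_seq p Q P).
Proof.
move=> out; apply/allP => S hS; apply: affine_out => i.
exact: (coset_seq_out (p := p) Qp out hS).
Qed.

(** [g] exists because the coset sums to [p P = 0]. Its translate [F] vanishes on the coset, which
    is stable under adding [Q], and to order [p] at [Q]. After multiplication by [k], the factor
    [(x - x(Q)) ^ p] can be divided out, and the quotient is proportional to [g] by
    [van_uniq_scal]. *)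
Lemma eigenfunction (P : cpt E) : P *+ p = 0 -> (forall i : nat, P <> Q *+ i) ->
  exists (g : crd q) (c : K), [/\ g != 0, van (pts (coset_seq p Q P)) g, (sz g <= p.+1)%N
    & forall Z : cpt E', affine Z -> Z <> Q' -> Z <> - Q' ->
      ev (cc (Z + Q')) (mapc phi g) * ev (cc Z) (mapc phi k)
        = phi c * ev (cc Z) (mapc phi g)].
Proof.
move=> Pp out; set T := coset_seq p Q P.
have aT : all (@affine K E) T by apply: coset_affine.
have sT : size (pts T) = p by rewrite size_pts // size_coset_seq.
have /princP[g [g0 vg sg]] : \sum_(S <- T) S = 0 by rewrite sum_coset_seq.
rewrite sT in sg.
have [F [vF sF eF]] := translate_exists phi aQ sg.
have NQ : - Q = Q *+ p.-1.
  by apply/eqP; rewrite eq_sym -addr_eq0 addrC -mulrS prednK ?prime_gt0 // Qp.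
(* The coset contains neither [Q] nor [- Q], so the formula for [F] applies on it, and its zeros add
   to the one at [Q]. *)
have vFT : van (pts T ++ nseq p (cc Q)) F.
  apply: van_uniq => //.
  - exact: onc_pts.
  - by apply: uniq_pts; apply: uniq_coset_seq.
  - move=> R /mapP[S]; rewrite mem_filter => /andP[aS hS] ->.
    apply/negP => /nseqP[e _].
    by apply: (coset_seq_out (i := 1) Qp out hS); rewrite mulr1n; apply: cc_inj.
  move=> R /mapP[S]; rewrite mem_filter => /andP[aS hS] ->.
  apply: (fmorph_inj phi); rewrite rmorph0 -ev_mapc -cc_map eF ?affine_map //.
  - rewrite -map_cptD (cc_map phi (S + Q)) [ev _ (mapc phi g)]ev_mapc.
    have hS' := coset_seq_succ Qp hS.
    have aS' : affine (S + Q) := allP aT _ hS'.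
    rewrite (van_ev _ _ vg) ?onc_cc ?mem_pts //.
    by rewrite rmorph0 mulr0.
  - move=> /map_cpt_inj e; apply: (coset_seq_out (i := 1) Qp out hS).
    by rewrite mulr1n.
  - rewrite -[- Q']/(- map_cpt phi Q) -raddfN => /map_cpt_inj e.
    by apply: (coset_seq_out (i := p.-1) Qp out hS); rewrite e NQ.
have vk' : van (nseq p (oppc (cc Q))) k.
  move: vk; rewrite -cc_opp // /pts; congr (van _ _).
  by rewrite (all_filterP _) ?map_nseq // all_nseq affine_opp aQ orbT.
have [g' vg' eg'] : exists2 g', van (pts T) g' & F * k = crdX q (cc Q) ^+ p * g'.
  apply: van_cancel_nseq; first exact: onc_cc.
  apply: van_perm (van_catM vFT vk'); apply/seq.permP => a.
  by rewrite !count_cat; lia.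
(* The pole order is at most [2 p] for [F], at most [p] for [k] and exactly [2 p] for
   [(x - x(Q)) ^ p], hence at most [p] for [g']. *)
have sg' : (sz g' <= p.+1)%N.
  have [->|g'0] := eqVneq g' 0; first by rewrite sz0.
  have := congr1 (@sz _ _) eg'; rewrite !szM // sz_crdXn //.
  have X0 : crdX q (cc Q) ^+ p != 0 by rewrite -(sz_eq0 szq) sz_crdXn.
  have : F * k != 0 by rewrite eg' crd_mul_eq0 // negb_or X0.
  rewrite crd_mul_eq0 // negb_or => /andP[F0 k0].
  rewrite (negPf F0) (negPf k0) (negPf X0) (negPf g'0) /=.
  move: sF sk; set x := sz F; set y := sz k; set z := sz g'.
  by clearbody x y z; clear - p x y z; lia.
have [c ec] : exists c : K, g' = crdp q c%:P * g.
  by apply: (van_uniq_scal szq (onc_pts T)); rewrite ?sT.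
exists g, c; split=> // Z aZ nZ nZ'.
have := congr1 (fun f => ev (cc Z) (mapc phi f)) eg'.
rewrite ec !rmorphM rmorphXn /= !evM ?onc_cc // eF // (mapc_crdp phi E c%:P).
rewrite map_polyC (ev_crdp _ _ _%:P) hornerC /=.
have -> : ev (cc Z) (mapc phi (crdX q (cc Q)) ^+ p) = ev (cc Z) (mapc phi (crdX q (cc Q))) ^+ p.
  elim: (p) => [|n ih]; first by rewrite !expr0 ev1.
  by rewrite !exprS evM ?onc_cc // ih.
rewrite -mulrA => /mulfI; apply; rewrite expf_neq0 //.
rewrite mapc_crdX -cc_map ev_crdX subr_eq0; apply/eqP => e.
have [] := cc_eq_fst aZ (_ : affine Q') e; first by rewrite affine_map.
  exact: nZ.
exact: nZ'.
Qed.

End Eigenfunction.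

(** * A root of unity from two independent torsion points *)

(** A cubic without roots is irreducible, so a root can be adjoined. *)
Lemma cubic_root_extension (K : fieldType) (f : {poly K}) : size f = 4%N ->
  exists (K' : fieldType) (phi : {rmorphism K -> K'}) (r : K'), root (map_poly phi f) r.
Proof.
move=> sf; have [[r hr]|nr] := classic (exists r, root f r).
  by exists K, idfun, r; rewrite map_poly_id.
have irr : irreducible_poly f.
  by apply: cubic_irreducible; rewrite ?sf // => x; apply/negP => hx; apply: nr; exists x.
by have [L _ [z hz _]] := irredp_FAdjoin irr; exists L, (in_alg L), z.
Qed.

Lemma two_torsion_point (K : fieldType) (E : smooth_curve K) r : root (cubic E) r ->
  exists R : cpt E, R != 0 /\ R + R = 0.
Proof.
(* The ordinate is chosen so that [Y = 0] after completing the square; the point is then its own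
   opposite. *)
move=> /eqP hr; have oR : on_curve E (Some (r, - (h1 E * r) - h3 E)).
  by rewrite on_curveE ?two_neq0 // /onc /= hr; apply/eqP; ring.
exists (exist (fun P : point K => on_curve E P) _ oR); split.
  by rewrite -[0]/(cpt0 E) -affine_neq.
apply/eqP; rewrite addr_eq0; apply/eqP; apply: val_inj => /=; congr (Some (_, _)).
by rewrite (wa1E _ (two_neq0 E)) (wa3E _ (two_neq0 E)); ring.
Qed.

Lemma mulrn_odd_torsion2 (V : zmodType) (R : V) n : odd n -> R + R = 0 -> R *+ n = R.
Proof.
move=> odd_n R2; rewrite -(odd_double_half n) odd_n mulrnDr mulr1n -mul2n mulrnA mulr2n R2.
by rewrite mul0rn addr0.
Qed.

(* Let [c1] and [c2] be the constants of [eigenfunction] for [P] and [- P].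
   Going once around the orbit of a 2-torsion point [R], [c1 ^ p = c2 ^ p]. If
   [c1 = c2], some combination of the two functions vanishes on [R + jQ]; these
   [p] points then sum to [0], whereas their sum is [pR = R]. *)
Theorem torsion_root_of_unity (K : fieldType) (E : smooth_curve K) (p : nat)
    (P Q : cpt E) : prime p -> odd p -> P *+ p = 0 -> Q *+ p = 0 -> Q != 0 ->
  (forall i : nat, P <> Q *+ i) -> exists2 zeta : K, zeta ^+ p = 1 & zeta != 1.
Proof.
move=> pr_p odd_p Pp Qp Q0 out.
have szq := size_cubic E; have p0 := prime_gt0 pr_p.
have [K' [phi [r]]] := cubic_root_extension szq; rewrite -cubic_map.
case/two_torsion_point => R [R0 R2].
set E' := map_curve phi E in R R0 R2; have szq' := size_cubic E'.
set Q' : cpt E' := map_cpt phi Q.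
have Qp' : Q' *+ p = 0 by rewrite -raddfMn /= Qp raddf0.
have Q0' : Q' != 0.
  by apply: contraNneq Q0 => e; apply/eqP/(@map_cpt_inj _ _ phi E); rewrite raddf0.
have Rp := mulrn_odd_torsion2 odd_p R2.
pose Z (j : nat) : cpt E' := R + Q' *+ j.
have Zp j : Z j *+ p = R by rewrite mulrnDl Rp -mulrnA mulnC mulrnA Qp' mul0rn addr0.
(* [p] times [Z j] is [R], which is nonzero, so the orbit avoids all [p]-torsion points coming from
   [E], in particular the zeros of [k] and of the two functions below. *)
have Zout j (U : cpt E) : U *+ p = 0 -> Z j <> map_cpt phi U.
  move=> Up e; move: (Zp j); rewrite e -raddfMn /= Up raddf0 => R0'.
  by rewrite -R0' eqxx in R0.
have aZ j : affine (Z j).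
  by apply/affineP => e; apply: (Zout j 0); rewrite ?mul0rn // e raddf0.
have ZS j : Z j + Q' = Z j.+1 by rewrite /Z mulrSr addrA.
have ZNp j : Z j <> - Q'.
  by rewrite -raddfN; apply: Zout; rewrite mulNrn Qp oppr0.
have aNQ : affine (- Q) by rewrite affine_neq oppr_eq0.
have sk' : size (pts (nseq p (- Q))) = p.
  by rewrite size_pts ?size_nseq // all_nseq aNQ orbT.
have /princP[k [k0 vk sk]] : \sum_(S <- nseq p (- Q)) S = 0.
  by rewrite big_nseq iter_addr_0 mulNrn Qp oppr0.
have NPp : (- P) *+ p = 0 by rewrite mulNrn Pp oppr0.
have outN (i : nat) : - P <> Q *+ i.
  move=> e; apply: (out (p.-1 * i)%N); apply: oppr_inj; rewrite e.
  apply/eqP; rewrite -addr_eq0 -mulrnDr -mulSn prednK // mulrnA Qp mul0rn //.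
have van_neq0 (s : seq (cpt E)) (f : crd (cubic E)) j : f != 0 -> van (pts s) f ->
    (sz f <= (size (pts s)).+1)%N -> (forall U, U \in s -> U *+ p = 0) ->
    ev (cc (Z j)) (mapc phi f) != 0.
  move=> f0 vf sf hs; apply: (@ev_neq0 _ E' (map (map_cpt phi) s) (mapc phi f) (Z j)) => //.
  - by rewrite mapc_eq0.
  - by rewrite pts_map; exact: van_mapc.
  - by rewrite sz_mapc pts_map size_map.
  - by apply/mapP => -[U /hs Up] /Zout; exact.
have kZ j : ev (cc (Z j)) (mapc phi k) != 0.
  by apply: (van_neq0 _ _ _ k0 vk sk) => U /nseqP[-> _]; rewrite mulNrn Qp oppr0.
rewrite sk' in sk.
have cosetp (U S : cpt E) : U *+ p = 0 -> S \in coset_seq p Q U -> S *+ p = 0.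
  by move=> Up /mapP[j _ ->]; rewrite mulrnDl Up add0r -mulrnA mulnC mulrnA Qp mul0rn.
have szc U : (forall i : nat, U <> Q *+ i) -> size (pts (coset_seq p Q U)) = p.
  by move=> h; rewrite size_pts ?size_coset_seq //; apply: coset_affine.
have [g1 [c1 [g10 vg1 sg1 e1]]] := eigenfunction phi pr_p odd_p Q0 Qp vk sk Pp out.
have [g2 [c2 [g20 vg2 sg2 e2]]] := eigenfunction phi pr_p odd_p Q0 Qp vk sk NPp outN.
have g1Z j : ev (cc (Z j)) (mapc phi g1) != 0.
  by apply: (van_neq0 _ _ _ g10 vg1); rewrite ?szc // => U /cosetp; exact.
have g2Z j : ev (cc (Z j)) (mapc phi g2) != 0.
  by apply: (van_neq0 _ _ _ g20 vg2); rewrite ?szc // => U /cosetp; exact.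
have step (g : crd (cubic E)) (c : K) :
    (forall Z : cpt E', affine Z -> Z <> Q' -> Z <> - Q' ->
      ev (cc (Z + Q')) (mapc phi g) * ev (cc Z) (mapc phi k)
        = phi c * ev (cc Z) (mapc phi g)) -> forall j,
    ev (cc (Z j.+1)) (mapc phi g) * ev (cc (Z j)) (mapc phi k)
      = phi c * ev (cc (Z j)) (mapc phi g).
  by move=> e j; rewrite -ZS; apply: e => //; apply: Zout.
move: (step _ _ e1) (step _ _ e2) => {step e1 e2} e1 e2.
pose kappa := \prod_(j < p) ev (cc (Z j)) (mapc phi k).
have kappaE (g : crd (cubic E)) (c : K) :
    (forall j, ev (cc (Z j)) (mapc phi g) != 0) ->
    (forall j, ev (cc (Z j.+1)) (mapc phi g) * ev (cc (Z j)) (mapc phi k)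
      = phi c * ev (cc (Z j)) (mapc phi g)) -> phi (c ^+ p) = kappa.
  (* The relation between consecutive points telescopes; after [p] steps the orbit closes up and the
     values of [g] cancel. *)
  move=> n0 e; have it n : ev (cc (Z n)) (mapc phi g) * \prod_(j < n) ev (cc (Z j)) (mapc phi k)
     = phi c ^+ n * ev (cc (Z 0%N)) (mapc phi g).
    elim: n => [|n ih]; first by rewrite big_ord0 expr0 mulr1 mul1r.
    by rewrite big_ord_recr /= mulrCA e mulrCA (mulrC (\prod_(_ < n) _)) ih exprS mulrA.
  have ZpE : Z p = Z 0%N by rewrite /Z Qp' mulr0n.
  by have := it p; rewrite ZpE mulrC rmorphXn => /(mulIf (n0 0%N)).
have k1 := kappaE _ _ g1Z e1; have k2 := kappaE _ _ g2Z e2.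
have c20 : c2 != 0.
  apply: contraTneq (_ : kappa != 0) => [e|]; last by apply/prodf_neq0.
  by rewrite -k2 e expr0n -[p]prednK //= rmorph0 eqxx.
have c12 : c1 ^+ p = c2 ^+ p by apply: (fmorph_inj phi); rewrite k1 k2.
exists (c1 / c2); first by rewrite exprMn exprVn c12 divff // expf_neq0.
apply/eqP => /(canRL (divfK c20)); rewrite mul1r => c1E; rewrite {}c1E in e1 {c12 k1}.
(* [t] makes [h] vanish at [Z 0]. Both functions now satisfy the same recurrence, so the zero
   propagates to every [Z j]. *)
pose t := ev (cc (Z 0%N)) (mapc phi g1) / ev (cc (Z 0%N)) (mapc phi g2).
have t0 : t != 0 by rewrite mulf_neq0 ?invr_eq0.
pose h := mapc phi g1 - crdp (cubic E') t%:P * mapc phi g2.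
have evh (U : cpt E') : affine U ->
    ev (cc U) h = ev (cc U) (mapc phi g1) - t * ev (cc U) (mapc phi g2).
  by move=> aU; rewrite /h evB evM ?onc_cc // ev_crdp hornerC.
have hZ j : ev (cc (Z j)) h = 0.
  elim: j => [|j ih]; first by rewrite evh // /t divfK ?subrr.
  apply: (mulIf (kZ j)); rewrite mul0r evh // mulrBl e1 -mulrA e2.
  by rewrite mulrCA -mulrBr -evh // ih mulr0.
(* At [P] the function [g1] vanishes and [g2] does not: otherwise [P] would lie in the coset of
   [- P], so that [2 P], and then [P] itself, would be a multiple of [Q]. *)
have h0 : h != 0.
  apply/eqP => h0; have aP : affine P := affine_out out.
  have aP' : affine (map_cpt phi P) by rewrite affine_map.
  have := evh _ aP'; rewrite h0 [LHS](_ : _ = 0); last by rewrite /ev !horner0 mul0r addr0.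
  rewrite cc_map !ev_mapc (van_ev _ _ vg1) ?onc_cc ?mem_pts //; last first.
    by apply/mapP; exists 0%N; rewrite ?mem_iota ?addr0.
  move/eqP; rewrite rmorph0 sub0r eq_sym oppr_eq0 mulf_eq0 (negPf t0) fmorph_eq0 /=.
  apply/negP; apply: (ev_neq0 g20 vg2); rewrite ?szc //.
  apply/mapP => -[j _ e]; apply: (out (p.+1./2 * j)%N).
  (* [p.+1./2] is the inverse of 2 modulo [p]. *)
  have : (P + P) *+ p.+1./2 = Q *+ j *+ p.+1./2 by rewrite {1}e addrAC addNr add0r.
  rewrite -mulr2n -!mulrnA mul2n [in LHS](_ : p.+1./2.*2 = p.+1); last first.
    by rewrite -[RHS]odd_double_half /= odd_p.
  by rewrite mulrSr Pp add0r mulnC.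
have /princP : princ (coset_seq p Q' R).
  have aC : all (@affine K' E') (coset_seq p Q' R) by apply/allP => S /mapP[j _ ->]; exact: aZ.
  exists h; split=> //.
    rewrite -[pts _]cats0; apply: van_uniq => //.
    - exact: onc_pts.
    - by apply: uniq_pts; apply: uniq_coset_seq.
    - by move=> S /mapP[T]; rewrite mem_filter => /andP[_ /mapP[j _ ->]] ->; exact: hZ.
  rewrite size_pts // size_coset_seq; apply: (szD szq'); first by rewrite sz_mapc.
  by rewrite szN (leq_trans (sz_scale _ _)) // sz_mapc.
rewrite sum_coset_seq // Rp => R0'; by rewrite R0' eqxx in R0.
Qed.

(** * The Galois action *)

Lemma prime_primitive_root (R : fieldType) p (w : R) :
  prime p -> w ^+ p = 1 -> w != 1 -> p.-primitive_root w.
Proof.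
move=> pr_p wp w1; have [m prim_w /(prime_nt_dvdP pr_p) m_p] :=
  prim_order_exists (prime_gt0 pr_p) wp.
rewrite -m_p //; apply: contraNneq w1 => m1; move: prim_w; rewrite m1.
by move/prim_expr_order; rewrite expr1 => ->.
Qed.

Lemma primitive_root_neq1 (R : fieldType) p (w : R) :
  prime p -> p.-primitive_root w -> w != 1.
Proof.
move=> pr_p prim_w; apply/eqP => w1.
have := prim_order_dvd prim_w 1; rewrite w1 expr1 eqxx dvdn1 => /eqP p1.
by move: pr_p; rewrite p1.
Qed.

(* The minimal polynomial of [z] divides ['X^p - 1], which splits in [L]. *)
Lemma conjugate_primitive_root (F : fieldType) (M L : fieldExtType F) p (z : M) (w : L) :
  prime p -> p.-primitive_root z -> p.-primitive_root w ->
  exists2 w' : L, p.-primitive_root w' & \dim <<1; w'>> = \dim <<1; z>>.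
Proof.
move=> pr_p prim_z prim_w.
have /polyOver1P[f Df] := minPolyOver 1 z.
have f_dvd : f %| 'X^p - 1.
  rewrite -(dvdp_map (in_alg M)) -Df rmorphB /= map_polyXn rmorph1.
  apply: minPoly_dvdp; first by rewrite rpredB ?rpredX ?polyOverX ?rpred1.
  by rewrite /root !hornerE (prim_expr_order prim_z) subrr.
(* A nonconstant divisor of [X ^ p - 1], the product of the [X - w ^ i], has some [w ^ i] as a
   root. *)
have [i rt_i] : exists i, root (map_poly (in_alg L) f) (w ^+ i).
  have : map_poly (in_alg L) f %| \prod_(0 <= i < p) ('X - (w ^+ i)%:P).
    rewrite (factor_Xn_sub_1 prim_w) -(rmorph1 (map_poly (in_alg L))).
    by rewrite -(map_polyXn (in_alg L)) -rmorphB dvdp_map.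
  case/dvdp_prod_XsubC => m Dm.
  have : size (\prod_(i <- mask m (index_iota 0 p)) ('X - (w ^+ i)%:P)) != 1%N.
    rewrite -(eqp_size Dm) size_map_poly -(size_map_poly (in_alg M)) -Df size_minPoly eqSS.
    by rewrite -lt0n.
  rewrite size_prod_XsubC; case: (mask m _) Dm => // i s Dm _.
  by exists i; rewrite (eqp_root Dm) big_cons rootM root_XsubC eqxx.
set w' := w ^+ i in rt_i; have /polyOver1P[g Dg] := minPolyOver 1 w'.
have g_dvd : map_poly (in_alg M) g %| minPoly 1 z.
  rewrite Df dvdp_map -(dvdp_map (in_alg L)) -Dg; apply: minPoly_dvdp rt_i.
  by apply/polyOver1P; exists f.
(* [g] is nonconstant and divides the irreducible minimal polynomial of [z], so [z] and [w'] have
   the same degree over [F]. *)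
have Dz : map_poly (in_alg M) g %= minPoly 1 z.
  have gM : map_poly (in_alg M) g \is a polyOver 1%VS by apply/polyOver1P; exists g.
  have /orP[//|/eqp_size] := minPoly_irr gM g_dvd.
  by rewrite size_map_poly -(size_map_poly (in_alg L)) -Dg size_minPoly size_poly1.
exists w'; last first.
  rewrite !dim_Fadjoin !dimv1 !muln1; apply/eqP; rewrite -eqSS -!size_minPoly.
  by rewrite -(eqp_size Dz) Dg !size_map_poly.
apply: prime_primitive_root => //.
  by rewrite /w' exprAC (prim_expr_order prim_w) expr1n.
(* If [w'] were 1, the shared minimal polynomial would be [X - 1], forcing [z = 1]. *)
apply: contraNneq (primitive_root_neq1 pr_p prim_z) => w'1.
have : minPoly 1 w' = 'X - w'%:P by apply/minPoly_XsubC; rewrite w'1 rpred1.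
rewrite Dg w'1 => e; have {e} g1 : g = 'X - 1.
  by apply: (map_poly_inj (in_alg L)); rewrite e rmorphB /= map_polyX !rmorph1.
have := root_minPoly 1 z; rewrite -(eqp_root Dz) g1 rmorphB /= map_polyX rmorph1.
by rewrite /root !hornerE subr_eq0.
Qed.

(** The quotient is [Gal(F(w) / F)], since [F(w)] is the splitting field of [X ^ p - 1] and hence
    normal. It is cyclic because [s w = w ^ (k s)] embeds it in the multiplicative group of
    ['F_p]. *)
Lemma cyclotomic_cyclic_quotient (F : fieldType) (L : splittingFieldType F) p (w : L) :
  prime p -> galois 1 {:L} -> p.-primitive_root w ->
  has_cyclic_quotient 'Gal({:L} / 1)%G (\dim <<1; w>>).
Proof.
move=> pr_p galL prim_w; pose M : {subfield L} := <<1; w>>%AS.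
have wM : w \in M by exact: memv_adjoin.
have nM : normalField 1 M.
  apply/splitting_normalField; first exact: sub1v.
  exists ('X^p - 1); first by rewrite rpredB ?rpredX ?polyOverX ?rpred1.
  exists [seq w ^+ i | i <- index_iota 0 p].
    by rewrite big_map (factor_Xn_sub_1 prim_w) eqpxx.
  apply/eqP; rewrite eqEsubv; apply/andP; split.
    apply/Fadjoin_seqP; split; first exact: sub1v.
    by move=> _ /mapP[i _ ->]; apply: rpredX.
  apply/FadjoinP; split; first exact: sub1v.
  apply: seqv_sub_adjoin; apply/mapP; exists 1%N; rewrite ?expr1 // mem_index_iota /=.
  exact: prime_gt1.
have galoisM : galois 1 M.
  have /and3P[_ sepL _] := galL; apply/and3P; split=> //; first exact: sub1v.
  by apply: separableSr sepL; exact: subvf.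
have root_gal (s : gal_of M) : {i : 'I_p | s w = w ^+ i}.
  by apply: (prim_rootP prim_w); rewrite -rmorphXn (prim_expr_order prim_w) rmorph1.
pose k s : 'F_p := (sval (root_gal s))%:R.
have kE (s : gal_of M) i : s w = w ^+ i -> k s = i%:R.
  move=> e; rewrite /k; case: (root_gal s) => j /= e'.
  move/eqP: e; rewrite e' (eq_prim_root_expr prim_w) => /eqP e.
  rewrite -[j%:R](GRing.natr_mod_pchar (pchar_Fp pr_p)) e.
  by rewrite (GRing.natr_mod_pchar (pchar_Fp pr_p)).
have cycM : cyclic 'Gal(M / 1).
  apply: (@field_mul_group_cyclic _ _ _ k) => [s t Gs Gt|s Gs].
    case: (root_gal s) (root_gal t) => [i ei] [j ej].
    rewrite (kE s i) // (kE t j) // -natrM; apply: kE.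
    by rewrite galM // ei rmorphXn /= ej -exprM mulnC.
  split=> [ks|->]; last by apply: (kE _ 1%N); rewrite gal_id expr1.
  apply/eqP; rewrite (gal_adjoin_eq Gs (group1 _)) gal_id.
  case: (root_gal s) => i ei; move: ks; rewrite (kE s i) // -[1]/(1%:R).
  move/(congr1 (@nat_of_ord _)); rewrite !val_Fp_nat // => ks.
  by rewrite ei -{2}[w]expr1 (eq_prim_root_expr prim_w) ks.
exists 'Gal({:L} / M)%G; have sM : (1 <= M <= {:L})%VS by rewrite sub1v subvf.
have iso := normalField_isog galL sM nM; split.
- exact: normalField_normal sM nM.
- by rewrite (isog_cyclic iso).
- by rewrite (card_isog iso) -(galois_dim galoisM) dimv1 divn1.
Qed.

Lemma pchar0_ext (F : fieldExtType rat) (L : fieldExtType F) : [pchar L] =i pred0.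
Proof. by move=> n; rewrite !pchar_lalg Num.Theory.pchar_num. Qed.

Section GaloisAction.
Variables (F : fieldType) (L : splittingFieldType F) (E : weierstrass F).
Let EL : weierstrass L := map_weierstrass (in_alg L) E.
Implicit Type s : gal_of {:L}.

Lemma gal_map_weierstrass s : map_weierstrass s EL = EL.
Proof. by rewrite /EL /map_weierstrass /= !rmorph_alg. Qed.

Lemma gal_on_curve s P : on_curve EL (map_point s P) = on_curve EL P.
Proof. by rewrite -{1}(gal_map_weierstrass s) map_on_curve. Qed.

Lemma gal_muln_point s n P : muln_point EL n (map_point s P) = map_point s (muln_point EL n P).
Proof. by rewrite -{1}(gal_map_weierstrass s) map_muln_point. Qed.

Definition point_in (K : {subfield L}) (P : point L) : bool :=
  if P is Some (x, y) then (x \in K) && (y \in K) else true.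

Lemma gal_point_in (K : {subfield L}) s P : s \in 'Gal({:L} / K)%g -> point_in K P ->
  map_point s P = P.
Proof.
case: P => [[x y]|] //= Ks /andP[Kx Ky].
by rewrite !(fixed_gal (subvf K) Ks).
Qed.

Lemma map_pointJ s (t : gal_of {:L}) P : map_point ((t ^ s)%g : gal_of {:L}) P =
  map_point s (map_point t (map_point (s^-1%g : gal_of {:L}) P)).
Proof. by case: P => [[x y]|] //=; rewrite conjgE !galM ?memvf. Qed.

Lemma map_pointKV s P : map_point s (map_point (s^-1%g : gal_of {:L}) P) = P.
Proof.
by case: P => [[x y]|] //=; rewrite -!galM ?memvf // mulVg !gal_id.
Qed.

Definition field_of_point (P : point L) : {subfield L} :=
  if P is Some (x, y) then <<<<1; x>>; y>>%AS else 1%AS.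

(** Fixing a point amounts to fixing the field generated by its coordinates. Stabilizers thereby
    become Galois groups, to which maximality can be applied. *)
Lemma gal_field_of_point s P :
  (s \in 'Gal({:L} / field_of_point P)%g) = (map_point s P == P).
Proof.
apply/idP/eqP=> [Ks|]; first apply: (gal_point_in Ks).
  case: P {Ks} => [[x y]|] //=; rewrite memv_adjoin andbT.
  exact/(subvP (subv_adjoin _ _))/memv_adjoin.
rewrite -sub1set galois_connection ?subvf //.
case: P => [[x y]|] /= e; last exact: sub1v.
have fixP a : s a = a -> a \in fixedField [set s].
  by move=> sa; apply/fixedFieldP; rewrite ?memvf // => t /set1P ->.
case: e => ex ey; apply/FadjoinP; split; last exact: fixP.
by apply/FadjoinP; split; [exact: sub1v | exact: fixP].
Qed.

Lemma field_of_point_sub (K : {subfield L}) P : point_in K P -> (field_of_point P <= K)%VS.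
Proof.
case: P => [[x y]|] /= => [/andP[Kx Ky]|_]; last exact: sub1v.
by apply/FadjoinP; split=> //; apply/FadjoinP; split=> //; exact: sub1v.
Qed.

Lemma point_in_field (K : {subfield L}) P : (field_of_point P <= K)%VS -> point_in K P.
Proof.
case: P => [[x y]|] //= /FadjoinP[/FadjoinP[_ Kx] Ky]; exact/andP.
Qed.

End GaloisAction.

(** * Descent of torsion points *)

Lemma torsion_descent (F : fieldType) (Lhat : splittingFieldType F)
    (L : {subfield Lhat}) (E : weierstrass F) (P : point Lhat) :
  galois 1 {:Lhat} -> maximal 'Gal({:Lhat} / L)%g 'Gal({:Lhat} / 1)%g ->
  ~~ ('Gal({:Lhat} / L) <| 'Gal({:Lhat} / 1))%g ->
  point_in L P -> ~~ point_in 1 P ->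
  exists s : gal_of {:Lhat}, forall i,
    map_point s P <> muln_point (map_weierstrass (in_alg Lhat) E) i P.
Proof.
move=> galL /maxgroupP[_ maxH] nonnormal PL P1.
set EL := map_weierstrass _ E; set M := field_of_point P.
have sHM : 'Gal({:Lhat} / L)%g \subset 'Gal({:Lhat} / M)%g.
  exact/galS/field_of_point_sub.
have sMG : 'Gal({:Lhat} / M)%g \subset 'Gal({:Lhat} / 1)%g by exact/galS/sub1v.
have eH : 'Gal({:Lhat} / M)%g = 'Gal({:Lhat} / L)%g.
  apply: maxH sHM.
  (* If the stabilizer were the whole group, the coordinates of [P] would lie in the base field. *)
  rewrite properEneq sMG andbT; apply: contraNneq P1 => eG.
  have /galois_fixedField eM : galois M {:Lhat}.
    by apply: galoisS galL; rewrite sub1v subvf.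
  have /galois_fixedField e1 := galL.
  by apply: point_in_field; rewrite -/M -[M : {vspace _}]eM eG e1.
apply: NNPP => noS; case/negP: nonnormal.
have multiple (s : gal_of {:Lhat}) : exists i, map_point s P = muln_point EL i P.
  by apply: NNPP => no; apply: noS; exists s => i e; apply: no; exists i.
apply/andP; split; first exact/galS/sub1v.
apply/subsetP => s _; rewrite inE; apply/subsetP => _ /imsetP[t Ht ->].
rewrite -eH !gal_field_of_point in Ht *; apply/eqP.
(* The image of [P] under the inverse of [s] is a multiple of [P], hence fixed by [t]; so [t ^ s]
   fixes [P], and the stabilizer is normal. *)
have [i ei] := multiple (s^-1)%g.
rewrite -[RHS](map_pointKV s) ei -[in RHS](eqP Ht) gal_muln_point -ei.
exact: map_pointJ.
Qed.

Theorem theorem4p1 (F : fieldExtType rat) (Lhat : splittingFieldType F)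
    (L : {subfield Lhat}) (hLhat : is_normal_closure L)
    (hmax : maximal 'Gal({:Lhat} / L)%g 'Gal({:Lhat} / 1)%g)
    (hnonnormal : ~~ ('Gal({:Lhat} / L) <| 'Gal({:Lhat} / 1))%g)
    (p : nat) (hp : prime p)
    (M : fieldExtType F) (zeta : M) (hzeta : (p.-primitive_root zeta)%R)
    (a : nat) (ha : a = \dim <<1; zeta>>%VS)
    (hquot : ~ has_cyclic_quotient 'Gal({:Lhat} / 1)%G a)
    (E : weierstrass F) (hE : elliptic E) :
  torsion_points E L p =i torsion_points E 1%AS p.
Proof.
have pr_p := hp; have char0 := pchar0_ext Lhat.
have two0 : (2 : Lhat) != 0 by rewrite ((GRing.pcharf0P _).1 char0).
have galL : galois 1 {:Lhat}.
  apply/and3P; split; [exact: sub1v | | exact: normalFieldf].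
  by apply/separableP => y _; exact: pcharf0_separable.
have ellL : elliptic (map_weierstrass (in_alg Lhat) E) by rewrite map_elliptic.
pose EL := SmoothCurve two0 ellL.
have torsionE (K : {subfield Lhat}) P : (P \in torsion_points E K p) =
    [&& on_curve EL P, muln_point EL p P == None & point_in K P].
  by rewrite inE /= inE /= -andbA; congr (_ && _); rewrite andbC.
move=> P; rewrite !torsionE; apply: andb_id2l => onP; apply: andb_id2l => /eqP mP.
apply/idP/idP => [PL|P1]; last first.
  by apply: point_in_field; apply: subv_trans (field_of_point_sub P1) (sub1v L).
apply: contraT => P1; case: hquot; rewrite ha.
have [s sP] := torsion_descent E galL hmax hnonnormal PL P1.
have [w wp w1] : exists2 w : Lhat, w ^+ p = 1 & w != 1.
  (* For [p = 2] the root is [-1]; the pairing is applied to odd [p]. *)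
  have [p2|odd_p] := even_prime pr_p.
    exists (-1); first by rewrite p2 sqrrN expr1n.
    by rewrite eq_sym -subr_eq0 opprK.
  have onS : on_curve EL (map_point s P) by rewrite gal_on_curve.
  pose Q : cpt EL := exist (fun S : point Lhat => on_curve EL S) _ onP.
  pose S : cpt EL := exist (fun S : point Lhat => on_curve EL S) _ onS.
  (* The conjugate [S] comes first: independence is stated as the first point not being a multiple
     of the second. *)
  apply: (@torsion_root_of_unity _ EL p S Q) => //.
  - by apply: val_inj; rewrite /= -sval_muln gal_muln_point mP.
  - by apply: val_inj; rewrite /= -sval_muln.
  - by apply: contraNneq P1 => /(congr1 sval) /= ->.
  - by move=> i /(congr1 sval); rewrite -sval_muln; exact: sP.
have prim_w := prime_primitive_root pr_p wp w1.
(* [zeta] lies in an extension [M] unrelated to [Lhat], so a primitive root in [Lhat] of the same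
   degree over [F] takes its place. *)
have [w' prim_w' <-] := conjugate_primitive_root pr_p hzeta prim_w.
exact: (cyclotomic_cyclic_quotient pr_p galL prim_w').
Qed.
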